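(* Let $n\ge2$, $N\ge1$, $p>1$, and let $\Omega\subset\mathbb{R}^n$ be a bounded smooth domain. Let $\boldsymbol u=(u^1,\ldots,u^N)\in C^1(\overline\Omega)$ be a weak solution of $$-\operatorname{\bf div}(|D\boldsymbol u|^{p-2}D\boldsymbol u)=\boldsymbol f(x,\boldsymbol u)\ \text{ in }\Omega,\qquad\boldsymbol u=0\ \text{ on }\partial\Omega,$$ with $u^\ell>0$ in $\Omega$ for every $\ell$, such that $|D\boldsymbol u|^{p-2}D\boldsymbol u\in W^{1,2}_{loc}(\Omega)$. If $\boldsymbol f$ is a positive function in $\Omega$, then the critical set $\mathcal Z_u=\{x\in\Omega:D\boldsymbol u(x)=0\}$ has zero Lebesgue measure.
   Context: For $\boldsymbol u=(u^1,\ldots,u^N)$, $D\boldsymbol u$ is the $N\times n$ matrix with rows $\nabla u^\ell$, $|D\boldsymbol u|=\big(\sum_{\ell,j}(\partial_{x_j}u^\ell)^2\big)^{1/2}$, $\mathcal M:\mathcal N=\sum_{i,j}\mathcal M^i_j\mathcal N^i_j$, and $|D\boldsymbol u|^{p-2}D\boldsymbol u$ is taken to be $0$ where $D\boldsymbol u=0$. Weak solution: $\boldsymbol u\in W^{1,p}_0(\Omega)$ and $\int_\Omega|D\boldsymbol u|^{p-2}D\boldsymbol u:D\boldsymbol\varphi\,dx=\int_\Omega\boldsymbol f(x,\boldsymbol u)\cdot\boldsymbol\varphi\,dx$ for all $\mathbb{R}^N$-valued $\boldsymbol\varphi\in W^{1,p}_0(\Omega)$. That $\boldsymbol f=(f^1,\ldots,f^N):\overline\Omega\times\mathbb{R}^N\to\mathbb{R}^N$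 is positive in $\Omega$ means $f^\ell(x,t_1,\ldots,t_N)>0$ for all $\ell$, all $x\in\Omega$ and all $t_1,\ldots,t_N>0$. *)

(* Defs.v *)
From HB Require Import structures.
From mathcomp Require Import all_boot all_order all_algebra.
From mathcomp Require Import all_classical all_reals all_analysis.

Set Implicit Arguments.
Unset Strict Implicit.
Unset Printing Implicit Defensive.
Import Order.TTheory GRing.Theory Num.Theory.
Import numFieldNormedType.Exports.

Local Open Scope classical_set_scope.
Local Open Scope ring_scope.

(* Lebesgue measure on R^n: the n-fold product of the one-dimensional Lebesgue
   measure is built on n-tuples by recursion on n, transported to row vectors,
   and completed (Caratheodory). *)
Section product_lebesgue.
Context {R : realType}.
Local Notation rT := (measurableTypeR R).

Definition cons_pair n (z : rT * n.-tuple rT) : n.+1.-tuple rT :=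
  [tuple of z.1 :: z.2].

Lemma measurable_cons_pair n : measurable_fun [set: rT * n.-tuple rT] (@cons_pair n).
Proof. exact: measurable_cons. Qed.

Lemma cons_pair_inv n (A : set (rT * n.-tuple rT)) : measurable A ->
  exists2 B : set (n.+1.-tuple rT), measurable B & @cons_pair n @^-1` B = A.
Proof.
move=> mA; pose g (t : n.+1.-tuple rT) : rT * n.-tuple rT :=
  (tnth t ord0, [tuple of behead t]).
have mg : measurable_fun setT g.
  by apply: measurable_fun_pair; [exact: measurable_tnth|exact: measurable_behead].
exists (g @^-1` A); first by rewrite -[X in measurable X]setTI; exact: mg.
apply/seteqP; split=> -[x t] /=; rewrite /g /cons_pair/= (tnth_nth x)/=;
  by rewrite (_ : [tuple of _] = t)//; apply/val_inj.
Qed.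

Section step.
Variables (n : nat) (m : {sigma_finite_measure set (n.-tuple rT) -> \bar R}).

Definition lebesgue_cons : set (n.+1.-tuple rT) -> \bar R :=
  pushforward (lebesgue_measure \x m)%E (@cons_pair n).

Let lebesgue_cons0 : lebesgue_cons set0 = 0%E.
Proof. by rewrite /lebesgue_cons /pushforward preimage_set0 measure0. Qed.

Let lebesgue_cons_ge0 A : (0 <= lebesgue_cons A)%E.
Proof. by rewrite /lebesgue_cons /pushforward; exact: measure_ge0. Qed.

Let lebesgue_cons_sigma_additive : semi_sigma_additive lebesgue_cons.
Proof.
move=> F mF tF mUF; rewrite /lebesgue_cons /pushforward preimage_bigcup.
have mp B : measurable B -> measurable (@cons_pair n @^-1` B).
  by move=> mB; rewrite -[X in measurable X]setTI; exact: measurable_cons_pair.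
apply: measure_semi_sigma_additive => [k|/=|]; first exact: mp.
  apply/trivIsetP => i j _ _ ij; rewrite -preimage_setI.
  by move/trivIsetP : tF => /(_ _ _ _ _ ij) ->//; rewrite preimage_set0.
by rewrite -preimage_bigcup; exact: mp.
Qed.

HB.instance Definition _ := isMeasure.Build _ _ _ lebesgue_cons
  lebesgue_cons0 lebesgue_cons_ge0 lebesgue_cons_sigma_additive.

Let lebesgue_cons_sigma_finite : sigma_finite setT lebesgue_cons.
Proof.
have [F FT Foo] : sigma_finite setT (lebesgue_measure \x m)%E.
  have /sigma_finiteP[A [AT ndA Aoo]] := sigma_finiteT (@lebesgue_measure R).
  have /sigma_finiteP[B [BT ndB Boo]] := sigma_finiteT m.
  exists (fun k => A k `*` B k) => [|k]; last first.
    have [mA A_fin] := Aoo k; have [mB B_fin] := Boo k.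
    split; first exact: measurableX.
    by rewrite product_measure1E// lte_mul_pinfty// ge0_fin_numE.
  apply/esym/seteqP; split=> // -[x t] _.
  have : (\bigcup_k A k) x by rewrite -AT.
  have : (\bigcup_k B k) t by rewrite -BT.
  move=> [i _ Bit] [j _ Ajx]; exists (maxn i j) => //; split => /=.
    by move: Ajx; exact/subsetPset/ndA/leq_maxr.
  by move: Bit; exact/subsetPset/ndB/leq_maxl.
have /choice[G GP] k : exists B : set (n.+1.-tuple rT),
    measurable B /\ @cons_pair n @^-1` B = F k.
  by have [B mB BF] := cons_pair_inv (Foo k).1; exists B.
exists G => [|k]; last first.
  by split; [exact: (GP k).1|rewrite /lebesgue_cons /pushforward (GP k).2; exact: (Foo k).2].
apply/esym/seteqP; split=> // t _.
have tE : t = cons_pair (thead t, [tuple of behead t]) by exact: tuple_eta.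
have : (\bigcup_i F i) (thead t, [tuple of behead t]) by rewrite -FT.
by move=> [k _]; rewrite -(GP k).2 /= -tE => Gt; exists k.
Qed.

HB.instance Definition _ := Measure_isSigmaFinite.Build _ _ _ lebesgue_cons
  lebesgue_cons_sigma_finite.

End step.

Fixpoint lebesgue_tuple n : {sigma_finite_measure set (n.-tuple rT) -> \bar R} :=
  match n with
  | 0 => \d_([tuple] : 0.-tuple rT)
  | n.+1 => lebesgue_cons (lebesgue_tuple n)
  end.
End product_lebesgue.

Section lebesgue_row.
Context {R : realType}.
Local Notation rT := (measurableTypeR R).
Variable n : nat.

Definition tuple_of_row (x : 'rV[R]_n) : n.-tuple rT := [tuple x ord0 i | i < n].

(* 'rV[R]_n with its Borel sets, generated by the coordinates *)
Definition borel_rV := g_sigma_algebra_preimageType tuple_of_row.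

Definition row_of_tuple (t : n.-tuple rT) : borel_rV := \row_i tnth t i.

Definition lebesgue_borel : set borel_rV -> \bar R :=
  pushforward (lebesgue_tuple n) row_of_tuple.

Lemma measurable_row_of_tuple :
  measurable_fun [set: n.-tuple rT] row_of_tuple.
Proof.
move=> _ _ [B mB <-]; rewrite !setTI.
rewrite (_ : _ @^-1` _ = B)//; apply/seteqP; split=> t /=;
  rewrite (_ : tuple_of_row (row_of_tuple t) = t)//;
  by apply: eq_from_tnth => i; rewrite tnth_mktuple mxE.
Qed.

Let mrow (A : set borel_rV) : measurable A -> measurable (row_of_tuple @^-1` A).
Proof. by move=> mA; rewrite -[X in measurable X]setTI; exact: measurable_row_of_tuple. Qed.

Let lebesgue_borel0 : lebesgue_borel set0 = 0%E.
Proof. by rewrite /lebesgue_borel /pushforward preimage_set0 measure0. Qed.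

Let lebesgue_borel_ge0 A : (0 <= lebesgue_borel A)%E.
Proof. by rewrite /lebesgue_borel /pushforward; exact: measure_ge0. Qed.

Let lebesgue_borel_sigma_additive : semi_sigma_additive lebesgue_borel.
Proof.
move=> F mF tF mUF; rewrite /lebesgue_borel /pushforward preimage_bigcup.
apply: measure_semi_sigma_additive => [k|/=|]; first exact: mrow.
  apply/trivIsetP => i j _ _ ij; rewrite -preimage_setI.
  by move/trivIsetP : tF => /(_ _ _ _ _ ij) ->//; rewrite preimage_set0.
by rewrite -preimage_bigcup; exact: mrow.
Qed.

HB.instance Definition _ := isMeasure.Build _ _ _ lebesgue_borel
  lebesgue_borel0 lebesgue_borel_ge0 lebesgue_borel_sigma_additive.

(* 'rV[R]_n with its Lebesgue measurable sets *)
Definition lebesgue_rV : measurableType _ :=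
  caratheodory_type (mu_ext lebesgue_borel).

Definition lebesgue_n : {measure set lebesgue_rV -> \bar R} :=
  @completed_measure_extension _ _ _ lebesgue_borel.
End lebesgue_row.
Arguments lebesgue_rV R n : clear implicits.
Arguments lebesgue_n R n : clear implicits.

Section differentiation.
Context {R : realType}.

Definition partial n (j : 'I_n) (v : 'rV[R]_n -> R) (x : 'rV[R]_n) : R :=
  'D_(delta_mx ord0 j) v x.

Definition smooth n (v : 'rV[R]_n -> R) :=
  forall s : seq 'I_n, continuous (foldr (@partial n) v s) /\
    forall (j : 'I_n) x, derivable (foldr (@partial n) v s) x (delta_mx ord0 j).

(* v is C^1 in Omega, and v and its gradient extend continuously to the
   closure of Omega. Values of v outside the closure are irrelevant. *)
Definition C1_closure n (Omega : set 'rV[R]_n) (v : 'rV[R]_n -> R) :=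
  {within closure Omega, continuous v} /\
  forall j : 'I_n,
    (forall x, Omega x -> derivable v x (delta_mx ord0 j)) /\
    exists2 g : 'rV[R]_n -> R, {within closure Omega, continuous g} &
      forall x, Omega x -> partial j v x = g x.

(* Near each of its points the boundary is, up to relabelling and reorienting
   the axes, the graph of a smooth function of the other n - 1 coordinates,
   and Omega lies on one side of it. *)
Definition smooth_boundary n (Omega : set 'rV[R]_n) :=
  forall x0, (closure Omega `\` interior Omega) x0 ->
    exists (r : R) (j : 'I_n) (s : bool) (gamma : 'rV[R]_n.-1 -> R),
      [/\ 0 < r, smooth gamma &
        forall x, ball x0 r x ->
          Omega x <-> 0 < (-1) ^+ s * (x ord0 j - gamma (col' j x))].

Definition bounded_smooth_domain n (Omega : set 'rV[R]_n) :=
  [/\ open Omega, Omega !=set0, connected Omega, bounded_set Omega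
    & smooth_boundary Omega].

Definition Dmx n N (u : 'rV[R]_n -> 'rV[R]_N) (x : 'rV[R]_n) : 'M[R]_(N, n) :=
  \matrix_(l, j) partial j (fun y => u y ord0 l) x.
End differentiation.

Section sobolev.
Context {R : realType} {n : nat}.
Implicit Types (Omega : set 'rV[R]_n) (p : R) (v : 'rV[R]_n -> R).
Local Notation mu := (lebesgue_n R n).

Definition test_function Omega (phi : 'rV[R]_n -> R) :=
  [/\ smooth phi, compact (closure [set x | phi x != 0])
    & closure [set x | phi x != 0] `<=` Omega].

Definition in_Lp Omega p v :=
  measurable_fun (Omega : set (lebesgue_rV R n)) v /\
  finite_norm mu p%:E (v \_ Omega).

Definition Lp_dist Omega p v w : \bar R :=
  'N[mu]_p%:E[ EFin \o ((v \- w) \_ Omega) ].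

Definition weak_partial Omega (j : 'I_n) v g :=
  forall phi, test_function Omega phi ->
    (\int[mu]_(x in Omega) (v x * partial j phi x)%:E =
     - \int[mu]_(x in Omega) (g x * phi x)%:E)%E.

(* v is in W^{1,p}(Omega) and g is a version of its weak gradient. *)
Definition sobolev Omega p v (g : 'I_n -> 'rV[R]_n -> R) :=
  in_Lp Omega p v /\
  forall j, in_Lp Omega p (g j) /\ weak_partial Omega j v (g j).

(* v is in W^{1,p}_0(Omega), the closure of the test functions in
   W^{1,p}(Omega), and g is a version of its weak gradient. *)
Definition sobolev0 Omega p v (g : 'I_n -> 'rV[R]_n -> R) :=
  sobolev Omega p v g /\
  forall e : R, 0 < e -> exists phi, [/\ test_function Omega phi,
    (Lp_dist Omega p v phi < e%:E)%E &
    forall j, (Lp_dist Omega p (g j) (partial j phi) < e%:E)%E].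

Definition W1p_loc Omega p v :=
  forall omega : set 'rV[R]_n, open omega -> compact (closure omega) ->
    closure omega `<=` Omega -> exists g, sobolev omega p v g.

Definition sobolev0_vec N Omega p (phi : 'rV[R]_n -> 'rV[R]_N)
    (Dphi : 'rV[R]_n -> 'M[R]_(N, n)) :=
  forall l : 'I_N,
    sobolev0 Omega p (fun x => phi x ord0 l) (fun j x => Dphi x l j).
End sobolev.

Section p_laplace.
Context {R : realType} {n N : nat}.
Implicit Types (Omega : set 'rV[R]_n) (p : R) (u : 'rV[R]_n -> 'rV[R]_N)
  (f : 'rV[R]_n -> 'rV[R]_N -> 'rV[R]_N).
Local Notation mu := (lebesgue_n R n).

Definition mxdot (A B : 'M[R]_(N, n)) : R := \sum_i \sum_j A i j * B i j.

Definition frobenius (A : 'M[R]_(N, n)) : R :=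
  Num.sqrt (\sum_i \sum_j A i j ^+ 2).

(* This is 0 where Du = 0, whatever the value of the scalar factor. *)
Definition p_flux p u (x : 'rV[R]_n) : 'M[R]_(N, n) :=
  frobenius (Dmx u x) `^ (p - 2) *: Dmx u x.

Definition vdot (a b : 'rV[R]_N) : R := \sum_l a ord0 l * b ord0 l.

(* The condition u = 0 on the boundary is the membership in W^{1,p}_0.
   The Du of p_flux is the classical one: u is meant to be C^1. The library
   integral is total, so the integrability of f(x, u) . phi is required
   explicitly. *)
Definition weak_solution Omega p f u :=
  (exists Du, sobolev0_vec Omega p u Du) /\
  forall phi Dphi, sobolev0_vec Omega p phi Dphi ->
    mu.-integrable Omega (fun x => (vdot (f x (u x)) (phi x))%:E) /\
    (\int[mu]_(x in Omega) (mxdot (p_flux p u x) (Dphi x))%:E =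
     \int[mu]_(x in Omega) (vdot (f x (u x)) (phi x))%:E)%E.

Definition positive_in Omega f :=
  forall (l : 'I_N) x (t : 'rV[R]_N), Omega x ->
    (forall k, 0 < t ord0 k) -> 0 < f x t ord0 l.

Definition critical_set Omega u : set 'rV[R]_n :=
  [set x | Omega x /\ Dmx u x = 0].
End p_laplace.

(* Main.v *)
From HB Require Import structures.
Require Import Defs.
From mathcomp Require Import all_boot all_order all_algebra.
From mathcomp Require Import all_classical all_reals all_analysis.
From mathcomp Require Import measurable_realfun ring lra.
Import Order.TTheory GRing.Theory Num.Theory.
Import numFieldNormedType.Exports.
Set Implicit Arguments.
Unset Strict Implicit.
Unset Printing Implicit Defensive.
Local Open Scope classical_set_scope.
Local Open Scope ring_scope.

(** Fix a component l and write V_1, ..., V_n for the entries of row l of the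
    flux |Du|^(p-2) Du.  Since p > 1 they are continuous in Omega and vanish
    exactly where row l of Du does.  The equation says that F = f^l(x, u) is
    minus the weak divergence of V, so F = - sum_j g_j, where g_j is the weak
    derivative of V_j in direction j.  The key fact is that a weak derivative
    of V_j vanishes almost everywhere on the set {V_j = 0}.  Hence F = 0
    almost everywhere on the critical set, whereas F > 0 there because f and u
    are positive; so the critical set is null.

    The key fact ([zero_level_continuous]) is proved in the weak form
    int_{V = 0} g zeta = 0 for continuous zeta of small support.  The classical
    proof uses the chain rule for H_k(V), with H_k small, H_k'(0) = 1, and
    H_k' -> 0 away from 0.  The chain rule is replaced here by an exact
    algebraic identity for difference quotients: with
    H_k(t) = t / (1 + (k t)^2) one has
    H_k(s) - H_k(t) = (s - t) c_k(s, t), c_k rational and bounded by 1.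
    Writing tau_h for the translation by h e_j,
      int (H_k(tau_h V) - H_k(V)) / h phi = int (tau_h V - V) / h c_k phi.
    On the left the difference quotient moves to phi by translation invariance
    of the measure, so the left side is O(1 / k) uniformly in h.  On the right
    the pairing with a continuous function is bounded by its sup norm times
    int |g| ([diff_pairing_le]) and tends to the pairing with g
    ([diff_pairing_cvg]), so that |int g c_k(V, V) phi| = O(1 / k); dominated
    convergence as k -> oo gives the claim, as c_k(t, t) tends to 1 if t = 0
    and to 0 otherwise.

    Two tools make this work.  The measure is invariant under translations
    ([lebesgue_n_shift]); this also yields integration by parts, hence that
    test functions are admissible in the equation ([sobolev0_supp]).  And
    continuous functions of compact support are uniform limits of smooth ones
    ([smooth_dense]), by a smooth partition of unity on a fine grid; this
    spares mollifiers and Fubini on the product of two copies of R^n.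

    Locally near a point ([critical_set_locally_null]), the identity
    int (F + sum_j g_j) zeta = 0 extends from smooth to continuous zeta, and is
    used for zeta = tent / (1 + i sum_j V_j^2) with i -> oo.  In the limit the
    terms in g_j vanish by the key fact, which leaves int_{V = 0} F tent = 0.
    Countably many such neighbourhoods cover the critical set
    ([null_of_locally_null]). *)

(** * Translation invariance of the n-dimensional Lebesgue measure *)

Lemma exists_pushforward d1 d2 (T1 : measurableType d1) (T2 : measurableType d2)
    (R : realType) (mu : {measure set T1 -> \bar R}) (f : T1 -> T2) :
  measurable_fun setT f ->
  exists m : {measure set T2 -> \bar R}, forall A, m A = mu (f @^-1` A).
Proof.
move=> mf.
by exists (measure_function_pushforward__canonical__measure_function_Measure mu mf).
Qed.

Section translation.
Context {R : realType}.
Local Notation rT := (measurableTypeR R).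

Lemma measurable_shiftR (a : R) :
  measurable_fun setT (fun x : rT => (x + a : rT)).
Proof. exact: measurable_funD. Qed.

Lemma lebesgue_measure_shift (a : R) (A : set rT) : measurable A ->
  lebesgue_measure ((fun x : rT => (x + a : rT)) @^-1` A) = lebesgue_measure A.
Proof.
move=> mA; apply/esym.
have [m mE] := exists_pushforward (@lebesgue_measure R) (measurable_shiftR a).
rewrite -mE; apply: (lebesgue_measure_unique (mu := m)) => // X [[c d] /= _ <-].
rewrite mE (_ : _ @^-1` _ = `]c - a, d - a]%classic).
  rewrite lebesgue_measure_itv [RHS]lebesgue_measure_itv /= !lte_fin ltrBlDr subrK.
  by case: ifP => // _; rewrite -!EFinD opprB addrA subrK.
by apply/seteqP; split => x /=; rewrite !in_itv/= ltrBlDr lerBrDr.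
Qed.

Definition shift_tuple n (a t : n.-tuple rT) : n.-tuple rT :=
  [tuple (tnth t i + tnth a i : rT) | i < n].

Lemma measurable_shift_tuple n (a : n.-tuple rT) :
  measurable_fun setT (shift_tuple a).
Proof.
apply/measurable_fun_tnthP => i.
rewrite (_ : _ \o _ = (fun x : rT => (x + tnth a i : rT)) \o (fun t => tnth t i)).
  apply: measurableT_comp; first exact: measurable_shiftR.
  exact: measurable_tnth.
by apply/funext => t /=; rewrite tnth_mktuple.
Qed.

(** The measure on (n+1)-tuples is the image of a product measure, and a product
    measure is determined by its values on rectangles; on these the claim
    reduces to dimension 1 and to the induction hypothesis. *)
Lemma lebesgue_tuple_shift n (a : n.-tuple rT) (A : set (n.-tuple rT)) :
  measurable A -> lebesgue_tuple n (shift_tuple a @^-1` A) = lebesgue_tuple n A.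
Proof.
elim: n a A => [|n IH] a A mA.
  congr (_ _); apply/seteqP; split=> t /=;
    by rewrite (tuple0 (shift_tuple a t)) (tuple0 t).
pose b : n.-tuple rT := [tuple of behead a].
pose S (z : rT * n.-tuple rT) : rT * n.-tuple rT :=
  ((z.1 + thead a : rT), shift_tuple b z.2).
have mS : measurable_fun setT S.
  apply: measurable_fun_pair.
    exact: (measurableT_comp (measurable_shiftR _) measurable_fst).
  exact: (measurableT_comp (measurable_shift_tuple _) measurable_snd).
have [m mE] := exists_pushforward
  (lebesgue_measure \x lebesgue_tuple n)%E mS.
rewrite /= /lebesgue_cons /pushforward.
have mc B : measurable B -> measurable (@cons_pair R n @^-1` B).
  by move=> mB; rewrite -[X in measurable X]setTI; exact: measurable_cons_pair.
have -> : @cons_pair R n @^-1` (shift_tuple a @^-1` A) = S @^-1` (@cons_pair R n @^-1` A).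
  apply/funext => -[x t]; rewrite /preimage /mkset; congr (A _).
  apply: eq_from_tnth => i; rewrite tnth_mktuple.
  have [->|[j ->]] : i = ord0 \/ exists j, i = lift ord0 j.
    by case: (unliftP ord0 i) => [j ->|->]; [right; exists j|left].
    by rewrite /cons_pair /= !tnth0 /thead.
  by rewrite /cons_pair /= !tnthS tnth_mktuple (tuple_eta a) tnthS.
rewrite -mE; apply/esym/product_measure_unique => //=; last exact: mc.
move=> B C mB mC; rewrite mE.
have -> : S @^-1` (B `*` C) =
  ((fun x : rT => (x + thead a : rT)) @^-1` B) `*` (shift_tuple b @^-1` C) by [].
pose B' : set rT := (fun x : rT => (x + thead a : rT)) @^-1` B.
transitivity (lebesgue_measure B' * lebesgue_tuple n (shift_tuple b @^-1` C))%E;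
    last first.
  by rewrite lebesgue_measure_shift// IH.
apply: product_measure1E.
- by rewrite -[X in measurable X]setTI; exact: measurable_shiftR.
- by rewrite -[X in measurable X]setTI; exact: measurable_shift_tuple.
Qed.

Lemma borel_shift_preimage n (a : 'rV[R]_n) (A : set (borel_rV n)) :
  (@row_of_tuple R n) @^-1` ((fun x : 'rV[R]_n => x + a) @^-1` A) =
  shift_tuple (tuple_of_row a) @^-1` ((@row_of_tuple R n) @^-1` A).
Proof.
apply/funext => t; rewrite /preimage /mkset; congr (A _).
by apply/rowP => i; rewrite !mxE !tnth_mktuple.
Qed.

Lemma measurable_borel_shift n (a : 'rV[R]_n) :
  measurable_fun setT ((fun x : 'rV[R]_n => x + a) : borel_rV n -> borel_rV n).
Proof.
move=> _ _ [B mB <-]; rewrite !setTI.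
exists (shift_tuple (tuple_of_row a) @^-1` B).
  by rewrite -[X in measurable X]setTI; exact: measurable_shift_tuple.
rewrite setTI; apply/funext => x; rewrite /preimage /mkset; congr (B _).
by apply: eq_from_tnth => i; rewrite !tnth_mktuple !mxE.
Qed.

Lemma lebesgue_borel_shift n (a : 'rV[R]_n) (A : set (borel_rV n)) :
  measurable A ->
  lebesgue_borel ((fun x : 'rV[R]_n => x + a) @^-1` A) = lebesgue_borel A.
Proof.
move=> mA; rewrite /lebesgue_borel /pushforward borel_shift_preimage.
apply: lebesgue_tuple_shift.
by rewrite -[X in measurable X]setTI; exact: measurable_row_of_tuple.
Qed.

(** The completed measure is the outer measure induced by the Borel one, and
    translations carry measurable covers to measurable covers of the same total
    measure.  Hence the identity holds for all sets. *)
Lemma lebesgue_n_shift n (a : 'rV[R]_n) (A : set 'rV[R]_n) :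
  lebesgue_n R n (shift a @^-1` A) = lebesgue_n R n A.
Proof.
suff le (b : 'rV[R]_n) (B : set 'rV[R]_n) :
    (lebesgue_n R n (shift b @^-1` B) <= lebesgue_n R n B)%E.
  apply/eqP; rewrite eq_le le/=.
  have := le (- a) (shift a @^-1` A).
  rewrite (_ : shift (- a) @^-1` _ = A)//; apply/funext => x.
  by rewrite /preimage /mkset /shift subrK.
apply: le_ereal_inf_tmp => _ [F [mF BF] <-].
apply: ereal_inf_lbound; exists (fun k => shift b @^-1` (F k)).
  split=> [k|x /= /BF [k _ Fk]]; last by exists k.
  by rewrite -[X in measurable X]setTI; exact: measurable_borel_shift.
by congr (limn _); apply/funext => k; apply: eq_bigr => i _; exact: lebesgue_borel_shift.
Qed.

(** Exposes the Caratheodory criterion behind measurability. *)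
Lemma lebesgue_rV_measurableE n (A : set 'rV[R]_n) :
  measurable (A : set (lebesgue_rV R n)) <->
  forall X : set 'rV[R]_n, lebesgue_n R n X =
    (lebesgue_n R n (X `&` A) + lebesgue_n R n (X `&` ~` A))%E.
Proof. by []. Qed.

Lemma measurable_shift n (a : 'rV[R]_n) :
  measurable_fun setT (shift a : lebesgue_rV R n -> lebesgue_rV R n).
Proof.
move=> _ B /lebesgue_rV_measurableE mB; rewrite setTI.
apply/lebesgue_rV_measurableE => X.
pose t := (fun x : 'rV[R]_n => x - a).
have tK (C : set 'rV[R]_n) :
    lebesgue_n R n (t @^-1` C) = lebesgue_n R n C by exact: lebesgue_n_shift.
have := mB (t @^-1` X); rewrite tK => ->.
rewrite -[in LHS](lebesgue_n_shift a)
  -[X in (_ + X)%E = _](lebesgue_n_shift a).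
have -> : shift a @^-1` (t @^-1` X `&` B) =
    X `&` shift a @^-1` B.
  by apply/funext => x; rewrite /preimage /mkset /setI /= /t addrK.
have -> : shift a @^-1` (t @^-1` X `&` ~` B) =
    X `&` ~` (shift a @^-1` B).
  by apply/funext => x; rewrite /preimage /mkset /setI /= /t addrK.
by [].
Qed.

End translation.

(** * The sup norm, Borel sets and local nullity on row vectors *)

Section row_space.
Context {R : realType} {n : nat}.
Implicit Types (x y : 'rV[R]_n) (e r : R).

(** The norm on row vectors is the sup norm: balls are cubes. *)
Lemma row_norm_ltP x e : 0 < e -> `|x| < e <-> forall i, `|x ord0 i| < e.
Proof.
move=> e0.
have -> : (`|x| < e) = (ball_ (fun y => `|y|) 0 e x) :> Prop by rewrite /ball_/= sub0r normrN.
rewrite -[ball_ _ _ _ _]/(@ball_ _ _ _ 0 e x) -mx_norm_ball.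
split=> [[_ b] i|b]; first by have := b ord0 i; rewrite /ball/= mxE sub0r normrN.
by split=> // i j; rewrite ord1 mxE /ball/= sub0r normrN.
Qed.

Lemma coord_le_norm x i : `|x ord0 i| <= `|x|.
Proof.
apply/ler_addgt0Pr => e e0; apply/ltW.
have e1 : 0 < `|x| + e by rewrite ltr_wpDl.
by move: i; apply/(row_norm_ltP _ e1); rewrite ltrDl.
Qed.

Lemma row_norm_le (x : 'rV[R]_n) (e : R) : 0 <= e ->
  (forall i, `|x ord0 i| <= e) -> `|x| <= e.
Proof.
move=> e0 xe; apply/ler_addgt0Pr => d d0; apply/ltW.
apply/row_norm_ltP => [|i]; first by rewrite ltr_wpDl.
by apply: le_lt_trans (xe i) _; rewrite ltrDl.
Qed.

Lemma norm_delta_le1 (j : 'I_n) : `|delta_mx ord0 j : 'rV[R]_n| <= 1.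
Proof.
by apply: row_norm_le => // i; rewrite mxE; case: (_ && _); rewrite ?normr1 ?normr0.
Qed.

(** A countable base of the topology. *)
Definition rat_ball (qk : 'rV[rat]_n * nat) : set 'rV[R]_n :=
  ball (map_mx ratr qk.1 : 'rV[R]_n) (qk.2.+1%:R^-1 : R).

Lemma rat_ball_nbhs x (U : set 'rV[R]_n) : nbhs x U ->
  exists2 qk, rat_ball qk x & rat_ball qk `<=` U.
Proof.
move=> /nbhs_ballP[e /= e0 eU].
have [k] := ltr_add_invr (divr_gt0 e0 (ltr0n R 2)); rewrite add0r => ke.
have k0 : 0 < (k.+1%:R^-1 : R) by rewrite invr_gt0.
have /choice[q qP] (i : 'I_n) : exists q : rat, `|ratr q - x ord0 i| < (k.+1%:R^-1 : R).
  have xk : x ord0 i < x ord0 i + k.+1%:R^-1 by rewrite ltrDl.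
  have [q /[!in_itv]/= /andP[q1 q2]] := rat_in_itvoo xk.
  by exists q; rewrite gtr0_norm ?subr_gt0// ltrBlDl.
pose y : 'rV[R]_n := map_mx ratr (\row_i q i).
have yx : `|y - x| < k.+1%:R^-1.
  by apply/row_norm_ltP => // i; rewrite !mxE.
exists (\row_i q i, k); first by rewrite /rat_ball/= -ball_normE.
move=> z; rewrite /rat_ball/= -ball_normE/= => yz; apply: eU.
rewrite -ball_normE/= (splitr e) -(subrK y x) -addrA.
by rewrite (le_lt_trans (ler_normD _ _))// ltrD// (lt_trans _ ke)// distrC.
Qed.

Lemma measurable_coord (i : 'I_n) : measurable_fun setT
  ((fun x => x ord0 i) : lebesgue_rV R n -> measurableTypeR R).
Proof.
move=> _ B mB; rewrite setTI; apply: caratheodory_measurable_mu_ext.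
exists ((fun t => tnth t i) @^-1` B).
  by rewrite -[X in measurable X]setTI; exact: measurable_tnth.
rewrite setTI; apply/funext => x.
by rewrite /preimage /mkset tnth_mktuple.
Qed.

Lemma measurable_ball_rV x e : measurable (ball x e : set (lebesgue_rV R n)).
Proof.
have [e0|e0] := ltP 0 e; last first.
  rewrite (_ : ball x e = set0)//; apply/seteqP; split => // y [].
  by rewrite ltNge e0.
rewrite (_ : ball x e = \bigcap_(i in [set: 'I_n])
    ((fun y => y ord0 i) @^-1` ball (x ord0 i) e)); last first.
  apply/seteqP; split => [y [_ b] i _|y b]; first exact: b.
  by split=> // j i; rewrite ord1; exact: b.
apply: fin_bigcap_measurable => // i _.
rewrite -[X in measurable X]setTI; apply: measurable_coord => //.
exact: measurable_ball.
Qed.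

Lemma measurable_open_rV (A : set 'rV[R]_n) : open A ->
  measurable (A : set (lebesgue_rV R n)).
Proof.
move=> oA.
have -> : A = \bigcup_(qk in [set qk | rat_ball qk `<=` A]) rat_ball qk.
  apply/seteqP; split => [x Ax|x [qk + ]]; last exact.
  by have [qk qkx qkA] := rat_ball_nbhs (open_nbhs_nbhs (conj oA Ax)); exists qk.
rewrite bigcup_mkcond; apply: countable_bigcupT_measurable => // qk.
by case: ifP => // _; exact: measurable_ball_rV.
Qed.

Lemma measurable_continuous_rV (D : set 'rV[R]_n) (f : 'rV[R]_n -> R) :
  open D -> {in D, continuous f} ->
  measurable_fun (D : set (lebesgue_rV R n)) f.
Proof.
move=> oD cf; apply: (measurability _ (RGenOInfty.measurableE R)).
move=> /= _ [_ [a ->]] <-; apply: measurable_open_rV.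
rewrite openE => x [Dx]; rewrite /= in_itv/= andbT => fx.
rewrite /interior; apply: filterI; first exact: (open_nbhs_nbhs (conj oD Dx)).
have h : nbhs x [set y | a < f y] := cf x (mem_set Dx) _ (lt_nbhsr fx).
by apply: filterS h => y /=; rewrite in_itv/= andbT.
Qed.

(** Lindelof: the rational balls meeting the set in a null set cover it, and
    they are countably many. *)
Lemma null_of_locally_null (Z : set 'rV[R]_n) :
  (forall x, Z x -> exists2 U, nbhs x U & lebesgue_n R n (Z `&` U) = 0%E) ->
  lebesgue_n R n Z = 0%E.
Proof.
move=> Zloc; apply/eqP; rewrite eq_le measure_ge0 andbT.
pose G (qk : 'rV[rat]_n * nat) : set 'rV[R]_n :=
  if pselect (lebesgue_n R n (Z `&` rat_ball qk) = 0%E) then Z `&` rat_ball qk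
  else set0.
pose F k := if unpickle k is Some qk then G qk else set0.
have F0 k : lebesgue_n R n (F k) = 0%E.
  rewrite /F /G; case: unpickle => [qk|]; last exact: measure0.
  by case: pselect => h /=; [exact: h|exact: measure0].
apply: (@le_trans _ _ (lebesgue_n R n (\bigcup_k F k))).
  apply: le_mu_ext => x Zx; have [U xU ZU] := Zloc _ Zx.
  have [qk qkx qkU] := rat_ball_nbhs xU.
  exists (pickle qk) => //; rewrite /F pickleK /G; case: pselect => //= -[].
  apply/eqP; rewrite eq_le measure_ge0 andbT -ZU.
  by apply: le_mu_ext => y [Zy /qkU].
apply: (@le_trans _ _ (\sum_(0 <= k <oo) lebesgue_n R n (F k))%E).
  by apply: mu_ext_sigma_subadditive => //= X; exact: measure_ge0.
by rewrite eseries0.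
Qed.
End row_space.

(** * Integrals on row vectors *)

Section integral_row_space.
Context {R : realType}.
Local Notation rT := (measurableTypeR R).

Definition cube n (M : R) : set (n.-tuple rT) :=
  [set t : n.-tuple rT | forall i, `|tnth t i : R| < M].

Arguments cube n M : clear implicits.

Lemma measurable_cube n (M : R) : measurable (cube n M).
Proof.
have -> : cube n M = \bigcap_(i in [set: 'I_n])
    ((fun t => tnth t i) @^-1` (ball 0 M : set R)).
  apply/seteqP; split => [t h i _|t h i].
    by rewrite /= -ball_normE/= sub0r normrN; exact: h.
  by have := h i Logic.I; rewrite /= -ball_normE/= sub0r normrN.
apply: fin_bigcap_measurable => // i _.
rewrite -[X in measurable X]setTI; apply: measurable_tnth => //.
exact: measurable_ball.
Qed.

Lemma lebesgue_tuple_cube n (M : R) : (lebesgue_tuple n (cube n M) < +oo)%E.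
Proof.
elim: n => [|n IH]; first by rewrite /= diracE; case: (_ \in _); rewrite ltry.
rewrite /= /lebesgue_cons /pushforward.
have -> : @cons_pair R n @^-1` cube n.+1 M = (ball 0 M : set rT) `*` cube n M.
  apply/seteqP; split => [[x t] h|[x t] [/= h1 h2] i].
    split; first by have /= := h ord0; rewrite tnth0 -ball_normE/= sub0r normrN.
    by move=> i /=; have /= := h (lift ord0 i); rewrite tnthS.
  have [->|[k ->]] : i = ord0 \/ exists k, i = lift ord0 k.
    by case: (unliftP ord0 i) => [k ->|->]; [right; exists k|left].
    by rewrite tnth0 /=; move: h1; rewrite -ball_normE/= sub0r normrN.
  by rewrite tnthS.
pose B : set rT := ball 0 M.
have -> : (lebesgue_measure \x lebesgue_tuple n)%E (B `*` cube n M) =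
    (lebesgue_measure B * lebesgue_tuple n (cube n M))%E.
  by apply: product_measure1E; [exact: measurable_ball|exact: measurable_cube].
apply: lte_mul_pinfty => //.
rewrite ge0_fin_numE// /B ball_itv lebesgue_measure_itv/=; case: ifP => // _.
by rewrite -EFinD ltry.
Qed.

Variable n : nat.
Local Notation mu := (lebesgue_n R n).
Local Notation intg f := (mu.-integrable setT (EFin \o f)).

(** A ball of the sup norm is a cube, whose measure is a product of lengths. *)
Lemma lebesgue_n_ball (x : 'rV[R]_n) (r : R) : (mu (ball x r) < +oo)%E.
Proof.
rewrite -(lebesgue_n_shift x) (_ : _ @^-1` _ = (ball 0 r : set 'rV[R]_n)); last first.
  apply/funext => y; rewrite /preimage /mkset -!ball_normE/= sub0r normrN.
  by rewrite /shift opprD addrCA subrr addr0 normrN.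
have [r0|r0] := ltP 0 r; last first.
  rewrite (_ : ball 0 r = set0) ?measure0//.
  by apply/seteqP; split => // y []; rewrite ltNge r0.
have CE : (ball 0 r : set 'rV[R]_n) = (@tuple_of_row R n) @^-1` cube n r.
  apply/seteqP; split => [y|y h].
    rewrite -ball_normE/= sub0r normrN => /row_norm_ltP h i.
    by rewrite tnth_mktuple; exact: h.
  rewrite -ball_normE/= sub0r normrN; apply/row_norm_ltP => // i.
  by have := h i; rewrite tnth_mktuple.
have mB : measurable (ball 0 r : set (borel_rV n)).
  by rewrite CE; exists (cube n r); [exact: measurable_cube|rewrite setTI].
have -> : mu (ball 0 r) = lebesgue_borel (ball 0 r : set (borel_rV n)).
  exact: measurable_mu_extE.
rewrite /lebesgue_borel /pushforward (_ : _ @^-1` _ = cube n r) ?lebesgue_tuple_cube//.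
rewrite CE; apply/funext => t; rewrite /preimage /mkset.
rewrite (_ : tuple_of_row _ = t)//.
by apply: eq_from_tnth => i; rewrite tnth_mktuple mxE.
Qed.

Lemma integral_shift_ge0 (a : 'rV[R]_n) (f : 'rV[R]_n -> \bar R) :
  measurable_fun (setT : set (lebesgue_rV R n)) f -> (forall x, (0 <= f x)%E) ->
  (\int[mu]_x f (x + a)%R = \int[mu]_x f x)%E.
Proof.
move=> mf f0.
have := @ge0_integral_pushforward _ _ _ _ _ _ (measurable_shift a) mu setT f
  measurableT mf (fun x _ => f0 x).
rewrite preimage_setT => <-.
pose m := measure_function_pushforward__canonical__measure_function_Measure
  mu (measurable_shift a).
by apply: (@eq_measure_integral _ _ _ _ mu m) => A mA _; exact: lebesgue_n_shift.
Qed.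

Lemma measurable_fun_shift (a : 'rV[R]_n) d (T : measurableType d) (f : 'rV[R]_n -> T) :
  measurable_fun (setT : set (lebesgue_rV R n)) f ->
  measurable_fun (setT : set (lebesgue_rV R n)) (fun x => f (x + a)).
Proof. by move=> mf; apply: (measurableT_comp mf (measurable_shift a)). Qed.

Lemma integrable_shift (a : 'rV[R]_n) (f : 'rV[R]_n -> R) :
  intg f -> intg (fun x => f (x + a)).
Proof.
move=> /integrableP[mf foo]; apply/integrableP; split.
  exact: (measurable_fun_shift a mf).
have mnf : measurable_fun (setT : set (lebesgue_rV R n)) (fun x => `|(f x)%:E|%E).
  exact: measurableT_comp.
by rewrite (integral_shift_ge0 a mnf (fun x => abse_ge0 _)).
Qed.

Lemma Rintegral_shift (a : 'rV[R]_n) (f : 'rV[R]_n -> R) :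
  intg f -> \int[mu]_x f (x + a) = \int[mu]_x f x.
Proof.
move=> fi; congr fine; have fai := integrable_shift a fi.
have := @integral_pushforward _ _ _ _ _ _ (measurable_shift a) mu setT _ (measurable_int mu fi).
rewrite preimage_setT => /(_ fai measurableT) <-.
pose m := measure_function_pushforward__canonical__measure_function_Measure
  mu (measurable_shift a).
by apply: (@eq_measure_integral _ _ _ _ mu m) => A mA _; exact: lebesgue_n_shift.
Qed.

Lemma bounded_support_integrable (f : 'rV[R]_n -> R) (x0 : 'rV[R]_n) (r C : R) :
  measurable_fun (setT : set (lebesgue_rV R n)) f ->
  (forall x, `|f x| <= C) -> (forall x, f x != 0 -> ball x0 r x) -> intg f.
Proof.
move=> mf fC fr.
have -> : f = f \_ (ball x0 r : set (lebesgue_rV R n)).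
  apply/funext => x; rewrite patchE; case: ifPn => // /negP xr.
  by apply/eqP/negP => /negP /fr h; apply: xr; exact: mem_set.
rewrite -restrict_EFin.
apply/(integrable_mkcond (D := ball x0 r : set (lebesgue_rV R n))).
  exact: measurable_ball_rV.
apply: measurable_bounded_integrable.
- exact: measurable_ball_rV.
- exact: lebesgue_n_ball.
- exact: measurable_funTS.
- exists C; split; first exact: num_real.
  by move=> y Cy x _; exact: le_trans (fC x) (ltW Cy).
Qed.

Lemma integrable_mul_bounded (g h : 'rV[R]_n -> R) (C : R) :
  intg g -> measurable_fun (setT : set (lebesgue_rV R n)) h ->
  (forall x, `|h x| <= C) -> intg (fun x => g x * h x).
Proof.
move=> gi mh hC; apply: (integrableMl measurableT gi mh).
exists C; split; first exact: num_real.
by move=> y Cy x _; exact: le_trans (hC x) (ltW Cy).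
Qed.

Lemma le_Rintegral_mul (g h : 'rV[R]_n -> R) (C : R) :
  intg g -> measurable_fun (setT : set (lebesgue_rV R n)) h ->
  (forall x, `|h x| <= C) ->
  `|\int[mu]_x (g x * h x)| <= C * \int[mu]_x `|g x|.
Proof.
move=> gi mh hC; have ghi := integrable_mul_bounded gi mh hC.
apply: le_trans (le_normr_Rintegral measurableT ghi) _.
have ngi := integrable_norm gi.
rewrite -RintegralZl//; apply: le_Rintegral => //.
- exact: (integrable_norm ghi).
- exact: (@integrableZl _ _ _ _ _ _ C _ ngi).
- by move=> x _; rewrite normrM mulrC ler_wpM2r.
Qed.

End integral_row_space.

(** * A smooth step function on the real line *)

Section smooth_1D.
Context {R : realType}.
Implicit Types f g : R -> R.

(** Recursion on the derivative makes closure under products and inverses a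
    plain induction on the order. *)
Fixpoint n_derivable (k : nat) f : Prop :=
  if k is k'.+1 then (forall x, derivable f x 1) /\ n_derivable k' (derive1 f) else True.

Definition smooth1 f := forall k, n_derivable k f.

Lemma n_derivableS k f : n_derivable k.+1 f -> n_derivable k f.
Proof.
elim: k f => [//|k IH] f [df dk]; split => //.
exact: IH.
Qed.

Lemma n_derivable_cst k (c : R) : n_derivable k (cst c).
Proof.
elim: k c => [//|k IH] c; split=> [x|]; first exact: derivable_cst.
have -> : derive1 (cst c : R -> R) = cst 0 by apply/funext => x; exact: derive1_cst.
exact: IH.
Qed.

Lemma n_derivableD k f g : n_derivable k f -> n_derivable k g -> n_derivable k (f + g).
Proof.
elim: k f g => [//|k IH] f g [df fk] [dg gk]; split=> [x|]; first exact: derivableD.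
have -> : derive1 (f + g) = (derive1 f) + (derive1 g).
  by apply/funext => x; rewrite derive1E (deriveD (df x) (dg x)) -!derive1E.
exact: IH.
Qed.

Lemma n_derivableM k f g : n_derivable k f -> n_derivable k g -> n_derivable k (f * g).
Proof.
elim: k f g => [//|k IH] f g [df fk] [dg gk]; split=> [x|]; first exact: derivableM.
have -> : derive1 (f * g) = f * (derive1 g) + g * (derive1 f).
  by apply/funext => x; rewrite derive1E (deriveM (df x) (dg x)) -!derive1E.
by apply: n_derivableD; apply: IH => //; exact: n_derivableS.
Qed.

(** The derivative of 1 / f is - f' / f^2, a product of functions that are
    differentiable to the lower order, among them 1 / f itself. *)
Lemma n_derivableV k f : (forall x, f x != 0) -> n_derivable k f ->
  n_derivable k (fun x => (f x)^-1).
Proof.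
move=> f0; elim: k => [//|k IH] /[dup] fkS [df fk].
have fVk := IH (n_derivableS fkS).
split=> [x|]; first exact: derivableV.
have -> : derive1 (fun x => (f x)^-1) =
    cst (-1) * ((derive1 f) * ((fun x => (f x)^-1) * (fun x => (f x)^-1))).
  apply/funext => x; rewrite derive1E deriveV// -derive1E /= !fctE.
  by rewrite /GRing.scale/= expr2 invfM; ring.
apply: n_derivableM; first exact: n_derivable_cst.
by apply: n_derivableM => //; exact: n_derivableM.
Qed.

Lemma n_derivable_affine k f (a b : R) : n_derivable k f ->
  n_derivable k (fun x => f (a * x + b)).
Proof.
elim: k f => [//|k IH] f [df fk].
have fD (x : R) : is_derive x (1:R) (fun x : R => f (a * x + b)) ((derive1 f) (a * x + b) * a).
  have dl : is_derive x (1:R) (fun x : R => a * x + b) a.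
    have := is_deriveD (is_deriveZ a (is_derive_id x (1:R))) (is_derive_cst b x (1:R)).
    by rewrite addr0 /GRing.scale/= mulr1.
  have dfx : is_derive (a * x + b) (1:R) f ((derive1 f) (a * x + b)).
    by rewrite derive1E; apply/derivableP.
  exact: (@is_derive1_comp _ f (fun x : R => a * x + b) _ _ _ dfx dl).
split=> [x|]; first by have [] := fD x.
have -> : derive1 (fun x => f (a * x + b)) = (fun x => (derive1 f) (a * x + b)) * cst a.
  by apply/funext => x; rewrite derive1E; have [_ ->] := fD x.
by apply: n_derivableM; [exact: IH|exact: n_derivable_cst].
Qed.

Lemma poly_le_expR (p : {poly R}) : exists C : R, forall x, 0 <= x -> `|p.[x]| <= C * expR x.
Proof.
suff mono k : exists2 C : R, 0 <= C & forall x, 0 <= x -> x ^+ k <= C * expR x.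
  have /choice[C CP] k : exists C : R,
      0 <= C /\ forall x, 0 <= x -> x ^+ k <= C * expR x.
    by have [C C0 CP] := mono k; exists C.
  exists (\sum_(i < size p) `|p`_i| * C i) => x x0.
  rewrite horner_coef (le_trans (ler_norm_sum _ _ _))// mulr_suml ler_sum// => i _.
  rewrite normrM -mulrA ler_wpM2l// ger0_norm ?exprn_ge0//.
  exact: (CP i).2.
case: k => [|k].
  exists 1 => // x x0; rewrite expr0 mul1r; apply: le_trans (expR_ge1Dx _).
  by rewrite lerDl.
exists (k.+1`!%:R) => // x x0.
rewrite mulrC -ler_pdivrMr ?ltr0n ?fact_gt0//.
by apply: le_trans (expR_ge1Dxn k x0); rewrite lerDr.
Qed.

(** The functions P(1/x) exp(-1/x) on x > 0, extended by 0, form a class stable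
    under differentiation that contains exp(-1/x). *)
Definition flat (p : {poly R}) (x : R) : R :=
  if 0 < x then p.[x^-1] * expR (- x^-1) else 0.

(** On x > 0 this is the product rule.  At 0 the difference quotient is x Q(1/x)
    exp(-1/x) with Q = X^2 P, and the exponential beats any polynomial in 1/x. *)
Lemma is_derive_flat (p : {poly R}) (x : R) :
  is_derive x 1 (flat p) (flat ('X^2 * (p - p^`())) x).
Proof.
have [x0|x0|<-{x}] := ltgtP 0 x.
- have : is_derive x 1 (fun x => p.[x^-1] * expR (- x^-1)) (flat ('X^2 * (p - p^`())) x).
    have xV : is_derive x 1 (fun x : R => x^-1) (- x ^- 2).
      have xN0 : x != 0 by rewrite gt_eqF.
      apply: DeriveDef; first by apply: (@derivableV _ _ id) => //.
      rewrite (@deriveV _ _ id)//.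
      by rewrite derive_id /GRing.scale/= mulr1.
    have d1 : is_derive x 1 (fun x : R => p.[x^-1]) (p^`().[x^-1] * - x ^- 2).
      exact: (@is_derive1_comp _ (horner p) (fun x : R => x^-1) _ _ _ (is_derive_poly p x^-1) xV).
    have xNV : is_derive x 1 (fun x : R => - x^-1) (x ^- 2).
      by have := is_deriveN xV; rewrite opprK.
    have d2 : is_derive x 1 (fun x : R => expR (- x^-1)) (expR (- x^-1) * x ^- 2).
      exact: (@is_derive1_comp _ expR (fun x : R => - x^-1) _ _ _ (is_derive_expR (- x^-1)) xNV).
    apply: (is_derive_eq (is_deriveM d1 d2)).
    rewrite /flat x0 !hornerE /GRing.scale/= exprVn; ring.
  apply: near_eq_is_derive.
  have h : \forall y \near x, 0 < y by exact: lt_nbhsr.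
  by near=> y; rewrite /flat (_ : 0 < y)//; near: y.
- have -> : flat ('X^2 * (p - p^`())) x = 0 by rewrite /flat ltNge (ltW x0).
  have := is_derive_cst (0:R) x (1:R).
  apply: near_eq_is_derive.
  have h : \forall y \near x, y < 0 by exact: lt_nbhsl.
  by near=> y; rewrite /flat ltNge ltW//; near: y.
- have -> : flat ('X^2 * (p - p^`())) 0 = 0 by rewrite /flat ltxx.
  suff cv : (fun h => h^-1 *: ((flat p \o shift 0) (h *: 1) - flat p 0)) @ 0^' --> (0:R).
    by apply: DeriveDef; [apply/cvg_ex; exists 0|exact/cvg_lim].
  have [C CP] := poly_le_expR ('X^2 * p).
  (* The bound for the polynomial X^2 p, taken at 1 / h, gains a factor |h|. *)
  have CP' h : `|h^-1 *: ((flat p \o shift 0) (h *: (1:R)) - flat p 0)| <= C * `|h|.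
    have C0 : 0 <= C by have := CP 0 (lexx _); rewrite expR0 mulr1; apply: le_trans.
    rewrite /flat /= ltxx subr0 addr0 /GRing.scale/= mulr1.
    case: ifPn => [h0|_]; last by rewrite mulr0 normr0 mulr_ge0.
    have hV0 : 0 <= h^-1 by rewrite invr_ge0 ltW.
    have := CP _ hV0; rewrite !hornerE !normrM (ger0_norm (expR_ge0 _)) => CPh.
    rewrite expRN ler_pdivrMr ?expR_gt0// (mulrAC C) -ler_pdivrMr ?normr_gt0 ?gt_eqF//.
    by move: CPh; rewrite -normfV mulrAC.
  apply/cvgr0Pnorm_le => /= e e0.
  have h : \forall h \near (0:R)^', `|h| < e / (`|C| + 1).
    apply: nbhs_dnbhs; apply: (@nbhs0_lt R R).
    by rewrite divr_gt0// ltr_wpDl.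
  apply: filterS h => h; rewrite ltr_pdivlMr ?ltr_wpDl// => he.
  apply: le_trans (CP' h) _; apply: le_trans (ltW he).
  by rewrite mulrC ler_wpM2l// (le_trans (ler_norm C))// lerDl.
Unshelve. all: by end_near. Qed.

Lemma smooth_flat p : smooth1 (flat p).
Proof.
move=> k; elim: k p => [//|k IH] p; split=> [x|]; first by have [] := is_derive_flat p x.
have -> : derive1 (flat p) = flat ('X^2 * (p - p^`())).
  by apply/funext => x; rewrite derive1E; have [_ ->] := is_derive_flat p x.
exact: IH.
Qed.

(** With e(x) = exp(-1/x) for x > 0, this is e(x) / (e(x) + e(1 - x)). *)
Definition step (x : R) : R := flat 1 x * (flat 1 x + flat 1 (-1 * x + 1))^-1.

Lemma flat1_ge0 x : 0 <= flat 1 x.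
Proof. by rewrite /flat; case: ifP => // _; rewrite hornerC mul1r expR_ge0. Qed.

Lemma flat1_gt0 x : 0 < x -> 0 < flat 1 x.
Proof. by move=> x0; rewrite /flat x0 hornerC mul1r expR_gt0. Qed.

Lemma flat1_le0 x : x <= 0 -> flat 1 x = 0.
Proof. by move=> x0; rewrite /flat ltNge x0. Qed.

Lemma step_den_gt0 x : 0 < flat 1 x + flat 1 (-1 * x + 1).
Proof.
have [x0|x0] := ltP 0 x; first by rewrite ltr_pwDl ?flat1_gt0 ?flat1_ge0.
rewrite ltr_wpDl ?flat1_ge0// flat1_gt0//; lra.
Qed.

Lemma smooth_step : smooth1 step.
Proof.
move=> k; apply: n_derivableM; first exact: smooth_flat.
apply: n_derivableV => [x|]; first by rewrite gt_eqF// step_den_gt0.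
apply: n_derivableD; first exact: smooth_flat.
by apply: n_derivable_affine; exact: smooth_flat.
Qed.

Lemma step_le0 x : x <= 0 -> step x = 0.
Proof. by move=> x0; rewrite /step flat1_le0// mul0r. Qed.

Lemma step_ge1 x : 1 <= x -> step x = 1.
Proof.
move=> x1; rewrite /step [X in _ + X]flat1_le0 ?addr0; last lra.
by rewrite mulfV// gt_eqF// flat1_gt0//; lra.
Qed.

Lemma flat1_homo : {homo flat 1 : x y / x <= y}.
Proof.
move=> x y xy; have [x0|x0] := ltP 0 x; last by rewrite flat1_le0// flat1_ge0.
have y0 : 0 < y by exact: lt_le_trans xy.
by rewrite /flat x0 y0 !hornerC !mul1r ler_expR lerN2 lef_pV2.
Qed.

Lemma step_homo : {homo step : x y / x <= y}.
Proof.
move=> x y xy; rewrite /step ler_pdivrMr ?step_den_gt0// mulrAC.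
rewrite ler_pdivlMr ?step_den_gt0//.
have h1 := flat1_homo xy.
have h2 : flat 1 (-1 * y + 1) <= flat 1 (-1 * x + 1) by apply: flat1_homo; lra.
rewrite !mulrDr [flat 1 x * flat 1 y]mulrC lerD2l.
by apply: ler_pM => //; exact: flat1_ge0.
Qed.

End smooth_1D.

(** * Smooth functions on row vectors *)

Section smooth_row.
Context {R : realType}.

(** Reduces derivatives along a line to derivatives in one variable. *)
Lemma is_derive_line (V W : normedModType R) (f : V -> W) (x v : V) (t : R) (d : W) :
  is_derive t (1 : R) (fun h : R => f (h *: v + x)) d <->
  is_derive (t *: v + x) v f d.
Proof.
have E : (fun h : R => h^-1 *: (((fun h : R => f (h *: v + x)) \o shift t) (h *: (1 : R)) -
      (fun h : R => f (h *: v + x)) t)) =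
    (fun h => h^-1 *: ((f \o shift (t *: v + x)) (h *: v) - f (t *: v + x))).
  by apply/funext => h /=; rewrite [_ *: 1]mulr1 scalerDl addrA.
by split=> -[df dfE]; apply: DeriveDef; move: df dfE; rewrite /derivable /derive E.
Qed.

Lemma continuous_at_shift n (f : 'rV[R]_n -> R) (a x : 'rV[R]_n) :
  {for x + a, continuous f} -> {for x, continuous (fun y : 'rV[R]_n => f (y + a))}.
Proof.
move=> cf; have ca : {for x, continuous (fun y : 'rV[R]_n => y + a)}.
  exact: (continuousD (@cvg_id _ (nbhs x)) (@cst_continuous _ _ a x)).
exact: (continuous_comp ca cf).
Qed.

Variable n : nat.
Implicit Types (F : 'I_n -> R -> R) (f g : 'rV[R]_n -> R).

Lemma smooth1_derive1n k (h : R -> R) : smooth1 h -> smooth1 (derive1n k h).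
Proof.
move=> sh; elim: k => [//|k IH]; rewrite derive1nS => m.
by have [] := IH m.+1.
Qed.

Lemma smooth1_derivable (h : R -> R) : smooth1 h -> forall x : R, derivable h x 1.
Proof. by move=> /(_ 1) []. Qed.

Lemma smooth1_affine (h : R -> R) (a b : R) : smooth1 h ->
  smooth1 (fun x => h (a * x + b)).
Proof. by move=> sh k; apply: n_derivable_affine. Qed.

Lemma smooth1_continuous (h : R -> R) : smooth1 h -> continuous h.
Proof.
move=> sh x; apply/differentiable_continuous/derivable1_diffP.
exact: smooth1_derivable.
Qed.

(** Products of functions of one variable: the partial derivatives of all orders
    stay in this class. *)
Definition tensor F (x : 'rV[R]_n) : R := \prod_i F i (x ord0 i).

Lemma is_derive_tensor F (j : 'I_n) x : (forall i (y : R), derivable (F i) y 1) ->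
  is_derive x (delta_mx ord0 j) (tensor F)
    (tensor (fun i => if i == j then derive1 (F i) else F i) x).
Proof.
move=> dF; set d := tensor _ x.
suff H : is_derive (0 : R) (1 : R) (fun h : R => tensor F (h *: delta_mx ord0 j + x)) d.
  by have := (is_derive_line _ _ _ _ _).1 H; rewrite scale0r add0r.
have -> : (fun h : R => tensor F (h *: delta_mx ord0 j + x)) =
    (fun h : R => (\prod_(i < n | i != j) F i (x ord0 i)) *: F j (1 * h + x ord0 j)).
  apply/funext => h; rewrite /tensor (bigD1 j)//= mulrC; congr (_ * _).
    apply: eq_bigr => i ij; rewrite !mxE eqxx (negbTE ij)/= mulr0 add0r//.
  by rewrite !mxE !eqxx mulr1 mul1r.
have -> : d = (\prod_(i < n | i != j) F i (x ord0 i)) *: derive1 (F j) (x ord0 j).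
  rewrite /d /tensor (bigD1 j)//= eqxx mulrC; congr (_ * _).
  by apply: eq_bigr => i /negbTE ->.
apply: is_deriveZ.
have dl : is_derive (0 : R) (1 : R) (fun h : R => 1 * h + x ord0 j) 1.
  have := is_deriveD (is_deriveZ 1 (is_derive_id (0:R) (1:R))) (is_derive_cst (x ord0 j) (0:R) (1:R)).
  by rewrite addr0 /GRing.scale/= mulr1.
have dFj : is_derive (1 * 0 + x ord0 j) (1:R) (F j) ((derive1 (F j)) (x ord0 j)).
  by rewrite mul1r add0r derive1E; apply/derivableP.
have := @is_derive1_comp _ (F j) (fun h : R => 1 * h + x ord0 j) _ _ _ dFj dl.
by rewrite mulr1.
Qed.

Lemma continuous_prod_row (I : Type) (s : seq I) (G : I -> 'rV[R]_n -> R) :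
  (forall i, continuous (G i)) -> continuous (fun x => \prod_(i <- s) G i x).
Proof.
move=> cG; elim: s => [|i s IH].
  have -> : (fun x => \prod_(i <- [::]) G i x) = cst 1.
    by apply/funext => x; rewrite big_nil.
  exact: cst_continuous.
have -> : (fun x => \prod_(i <- i :: s) G i x) =
    (fun x => G i x * \prod_(i <- s) G i x).
  by apply/funext => x; rewrite big_cons.
by move=> x; exact: (continuousM (cG i x) (IH x)).
Qed.

Lemma continuous_tensor F : (forall i, continuous (F i)) -> continuous (tensor F).
Proof.
move=> cF; apply: continuous_prod_row => i x.
apply: (@continuous_comp _ _ _ (fun x : 'rV[R]_n => x ord0 i) (F i)).
  exact: coord_continuous.
exact: cF.
Qed.

Lemma smooth_tensor F : (forall i, smooth1 (F i)) -> smooth (tensor F).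
Proof.
move=> sF s.
have -> : foldr (@partial R n) (tensor F) s =
    tensor (fun i => derive1n (count_mem i s) (F i)).
  elim: s => [//|j s IH] /=; rewrite IH; apply/funext => x; rewrite /partial.
  have [_ ->] := @is_derive_tensor (fun i => derive1n (count_mem i s) (F i)) j x
    (fun i => smooth1_derivable (smooth1_derive1n _ (sF i))).
  by apply: eq_bigr => i _; rewrite (eq_sym j); case: eqP => // _; rewrite add1n derive1nS.
split=> [|j x].
  by apply: continuous_tensor => i; apply/smooth1_continuous/smooth1_derive1n.
by have [] := @is_derive_tensor (fun i => derive1n (count_mem i s) (F i)) j x
    (fun i => smooth1_derivable (smooth1_derive1n _ (sF i))).
Qed.

Lemma smooth_partial f (j : 'I_n) : smooth f -> smooth (partial j f).
Proof. by move=> sf s; have := sf (rcons s j); rewrite foldr_rcons. Qed.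

Lemma smooth_continuous f : smooth f -> continuous f.
Proof. by move=> /(_ [::])[]. Qed.

Lemma smooth_derivable f (j : 'I_n) x : smooth f -> derivable f x (delta_mx ord0 j).
Proof. by move=> /(_ [::])[_]; exact. Qed.

Lemma smooth_cst (c : R) : smooth (fun _ : 'rV[R]_n => c).
Proof.
move=> s; suff [d ->] : exists d, foldr (@partial R n) (fun=> c) s = cst d.
  by split=> [|j x]; [exact: cst_continuous|exact: derivable_cst].
elim: s => [|j s [d /= ->]]; first by exists c.
by exists 0; apply/funext => x; rewrite /partial derive_cst.
Qed.

Lemma foldr_partialD f g s : smooth f -> smooth g ->
  foldr (@partial R n) (f + g) s =
  foldr (@partial R n) f s + foldr (@partial R n) g s.
Proof.
move=> sf sg; elim: s => [//|j s /= ->]; apply/funext => x.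
by rewrite /partial deriveD//; [exact: (sf s).2|exact: (sg s).2].
Qed.

Lemma smoothD f g : smooth f -> smooth g -> smooth (f + g).
Proof.
move=> sf sg s; rewrite foldr_partialD//.
have [cf df] := sf s; have [cg dg] := sg s.
by split=> [x|j x]; [exact: (continuousD (cf x) (cg x))|exact: derivableD].
Qed.

Lemma smoothZ (c : R) f : smooth f -> smooth (c *: f).
Proof.
move=> sf s.
have -> : foldr (@partial R n) (c *: f) s = c *: foldr (@partial R n) f s.
  elim: s => [//|j s /= ->]; apply/funext => x.
  by rewrite /partial deriveZ//; exact: (sf s).2.
have [cf df] := sf s.
by split=> [x|j x]; [exact: (continuousM (@cst_continuous _ _ c x) (cf x))|exact: derivableZ].
Qed.

Lemma smooth_sum (I : Type) (s : seq I) (G : I -> 'rV[R]_n -> R) :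
  (forall i, smooth (G i)) -> smooth (fun x => \sum_(i <- s) G i x).
Proof.
move=> sG; elim: s => [|i s IH].
  have -> : (fun x => \sum_(i <- [::]) G i x) = (fun=> 0).
    by apply/funext => x; rewrite big_nil.
  exact: smooth_cst.
have -> : (fun x => \sum_(i <- i :: s) G i x) =
    G i + (fun x => \sum_(i <- s) G i x).
  by apply/funext => x; rewrite big_cons.
exact: (smoothD (sG i) IH).
Qed.

Lemma partial_shift f (j : 'I_n) (a x : 'rV[R]_n) :
  partial j (fun y => f (y + a)) x = partial j f (x + a).
Proof.
rewrite /partial /derive; congr (lim (_ @ 0^')).
by apply/funext => h /=; rewrite addrA.
Qed.

Lemma smooth_shift f (a : 'rV[R]_n) : smooth f -> smooth (fun x => f (x + a)).
Proof.
move=> sf s.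
have -> : foldr (@partial R n) (fun x => f (x + a)) s =
    (fun x => foldr (@partial R n) f s (x + a)).
  by elim: s => [//|j s /= ->]; apply/funext => x; rewrite partial_shift.
have [cf df] := sf s; split=> [x|j x].
  exact: (continuous_at_shift (cf (x + a))).
have := df j (x + a); rewrite /derivable.
by under eq_fun do rewrite /= addrA.
Qed.

End smooth_row.

(** * Functions supported in a ball *)

Section compact_support.
Context {R : realType} {n : nat}.
Implicit Types (f g : 'rV[R]_n -> R) (r : R).

(** Quantitative control of the support: unlike membership in a compact set, it
    can be tracked through translations and approximations. *)
Definition supp_in (x0 : 'rV[R]_n) r f := forall x, f x != 0 -> `|x - x0| <= r.

Lemma supp_in_eq0 (x0 : 'rV[R]_n) r f x : supp_in x0 r f -> r < `|x - x0| -> f x = 0.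
Proof.
by move=> sf rx; apply/eqP/negP => /negP /sf; rewrite leNgt rx.
Qed.

Lemma supp_inM (x0 : 'rV[R]_n) r f g : supp_in x0 r f -> supp_in x0 r (fun x => g x * f x).
Proof. by move=> sf x; rewrite mulf_eq0 negb_or => /andP[_ /sf]. Qed.

Lemma continuous_dist (x0 : 'rV[R]_n) : continuous (fun x : 'rV[R]_n => `|x - x0|).
Proof.
move=> x; have h : {for x, continuous (fun y : 'rV[R]_n => y - x0)}.
  exact: (continuousD (@cvg_id _ (nbhs x)) (@cst_continuous _ _ (- x0) x)).
exact: (cvg_norm h).
Qed.

Lemma closed_dist_le (x0 : 'rV[R]_n) r : closed [set x : 'rV[R]_n | `|x - x0| <= r].
Proof.
have -> : [set x : 'rV[R]_n | `|x - x0| <= r] =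
    (fun x => `|x - x0|) @^-1` [set y | y <= r] by [].
by apply: closed_comp (@closed_le _ r) => x _; exact: continuous_dist.
Qed.

Lemma compact_dist_le (x0 : 'rV[R]_n) r : compact [set x : 'rV[R]_n | `|x - x0| <= r].
Proof.
apply: bounded_closed_compact; last exact: closed_dist_le.
exists (r + `|x0|); split; first exact: num_real.
move=> y ry x /= xr; apply/ltW; apply: le_lt_trans ry.
rewrite -(subrK x0 x) (le_trans (ler_normD _ _))// lerD2r//.
Qed.

(** Heine--Cantor, where only the first point is required to lie in the compact
    set and continuity is assumed at its points only. *)
Lemma unif_continuous_compact (K : set 'rV[R]_n) f (e : R) : compact K ->
  (forall x, K x -> {for x, continuous f}) -> 0 < e ->
  exists2 d, 0 < d & forall x y, K x -> `|y - x| < d -> `|f y - f x| < e.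
Proof.
move=> /compact_near_coveringP cK cf e0.
have := cK R (0 : R)^'+ (fun d x => forall y, `|y - x| < d -> `|f y - f x| < e) _.
have cov x : K x -> \forall x' \near x & i \near (0:R)^'+,
    forall y, `|y - x'| < i -> `|f y - f x'| < e.
  move=> Kx.
  have /cvgrPdist_lt/(_ _ (divr_gt0 e0 (ltr0n R 2))) := cf x Kx.
  move=> /nbhs_ballP[d /= d0 dx].
  exists (ball x (d / 2), [set i | i < d / 2]) => /=.
    split; first by apply: nbhsx_ballx; rewrite divr_gt0.
    by apply: nbhs_right_lt; rewrite divr_gt0.
  move=> [x' i] [/= x'x id] y yx'.
  move: x'x; rewrite -ball_normE/= => xx'.
  have xx'd : `|x - x'| < d by rewrite (lt_le_trans xx')// ler_pdivrMr// ler_pMr// ler1n.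
  have xyd : `|x - y| < d.
    rewrite -(subrK x' x) -addrA (le_lt_trans (ler_normD _ _))// (splitr d) ltrD//.
    by rewrite distrC (lt_trans yx').
  have h1 := dx x'; have h2 := dx y; rewrite -ball_normE/= in h1 h2.
  rewrite -(subrK (f x) (f y)) -addrA (le_lt_trans (ler_normD _ _))// (splitr e) ltrD//.
    by rewrite distrC; exact: h2.
  exact: h1.
move=> /(_ _ cov) H.
have [d /= [d0 dP]] : exists d, 0 < d /\
    K `<=` (fun x => forall y, `|y - x| < d -> `|f y - f x| < e).
  have H' : \forall i \near (0 : R)^'+,
      K `<=` (fun x => forall y, `|y - x| < i -> `|f y - f x| < e) /\ 0 < i.
    by apply: filterI; [exact: H|exact: nbhs_right_gt].
  by have [d [dP d0]] := filter_ex H'; exists d.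
by exists d => // x y Kx; exact: dP.
Qed.

Lemma unif_continuous_supp (x0 : 'rV[R]_n) r f (e : R) : continuous f -> supp_in x0 r f ->
  0 < e -> exists2 d, 0 < d & forall x y, `|y - x| < d -> `|f y - f x| < e.
Proof.
move=> cf sf e0.
have [d d0 dP] := unif_continuous_compact (@compact_dist_le x0 r) (fun x _ => cf x) e0.
exists d => // x y xy; have [xr|xr] := leP `|x - x0| r; first exact: dP.
have [yr|yr] := leP `|y - x0| r.
  by rewrite distrC; apply: dP => //; rewrite distrC.
by rewrite (supp_in_eq0 sf xr) (supp_in_eq0 sf yr) subrr normr0.
Qed.

Lemma bounded_supp (x0 : 'rV[R]_n) r f : continuous f -> supp_in x0 r f ->
  exists2 C, 0 <= C & forall x, `|f x| <= C.
Proof.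
move=> cf sf.
have := @continuous_compact _ _ f _ _ (@compact_dist_le x0 r).
move=> /(_ (continuous_subspaceT cf)) /compact_bounded[M [_ MP]].
exists (`|M| + 1) => [|x]; first by rewrite addr_ge0.
have M1 : M < `|M| + 1 by rewrite (le_lt_trans (ler_norm M))// ltrDl.
have [xr|xr] := leP `|x - x0| r; last by rewrite (supp_in_eq0 sf xr) normr0 addr_ge0.
by apply: MP => //; exists x.
Qed.

Lemma closure_supp (x0 : 'rV[R]_n) r f : supp_in x0 r f ->
  closure [set x | f x != 0] `<=` [set x | `|x - x0| <= r].
Proof.
move=> sf; rewrite [X in _ `<=` X]((closure_id _).1 (@closed_dist_le x0 r)).
exact: closure_subset.
Qed.

Lemma test_function_supp (x0 : 'rV[R]_n) r r' f : smooth f -> supp_in x0 r f -> r < r' ->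
  test_function (ball x0 r') f.
Proof.
move=> sf fr rr'; split => //.
  apply: (subclosed_compact _ (@compact_dist_le x0 r)); first exact: closed_closure.
  exact: closure_supp.
move=> x /(closure_supp fr)/= xr; rewrite -ball_normE/= distrC.
exact: le_lt_trans rr'.
Qed.

(** Off the closed ball the function vanishes near each point. *)
Lemma partial_supp (x0 : 'rV[R]_n) r f (j : 'I_n) : supp_in x0 r f -> supp_in x0 r (partial j f).
Proof.
move=> fr x; apply: contraNT; rewrite -ltNge => xr.
rewrite /partial -(derive_cst (0 : R) x (delta_mx ord0 j)); apply/eqP.
apply: near_eq_derive.
have h : \forall y \near x, r < `|y - x0|.
  exact: (@continuous_dist x0 x _ (lt_nbhsr xr)).
by apply: filterS h => y yr; rewrite (supp_in_eq0 fr yr).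
Qed.

Lemma continuousM_supp (x0 : 'rV[R]_n) r r' f g : r < r' ->
  (forall x, `|x - x0| < r' -> {for x, continuous g}) -> continuous f ->
  supp_in x0 r f -> continuous (fun x => g x * f x).
Proof.
move=> rr' cg cf fr x; have [xr'|xr'] := ltP `|x - x0| r'.
  exact: (continuousM (cg _ xr') (cf x)).
have xr := lt_le_trans rr' xr'.
have h : \forall y \near x, (cst 0 : 'rV[R]_n -> R) y = g y * f y.
  have h : \forall y \near x, r < `|y - x0|.
    exact: (@continuous_dist x0 x _ (lt_nbhsr xr)).
  by apply: filterS h => y yr; rewrite (supp_in_eq0 fr yr) mulr0.
rewrite /continuous_at (supp_in_eq0 fr xr) mulr0.
by apply: cvg_trans (near_eq_cvg h) _; exact: cvg_cst.
Qed.

(** Mean value theorem for increments of either sign. *)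
Lemma MVT_sym (F dF : R -> R) (h : R) :
  (forall t : R, is_derive t (1 : R) F (dF t)) ->
  exists2 c, `|c| <= `|h| & F h - F 0 = dF c * h.
Proof.
move=> dFP.
have cF a b : {within `[a, b], continuous F}.
  apply: continuous_subspaceT => t; apply/differentiable_continuous/derivable1_diffP.
  by have [] := dFP t.
have [h0|h0] := leP 0 h.
  have [c] := MVT_segment h0 (fun x _ => dFP x) (cF _ _).
  rewrite in_itv/= subr0 => /andP[c0 ch] E; exists c => //.
  by rewrite !ger0_norm// (le_trans c0).
have [c] := MVT_segment (ltW h0) (fun x _ => dFP x) (cF _ _).
rewrite in_itv/= sub0r => /andP[c0 ch] E; exists c.
  by rewrite !ler0_norm ?(ltW h0)// lerN2.
by rewrite -opprB E mulrN opprK.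
Qed.

Lemma increment_le f (j : 'I_n) (D h : R) x :
  (forall y, derivable f y (delta_mx ord0 j)) -> (forall y, `|partial j f y| <= D) ->
  `|f (x + h *: delta_mx ord0 j) - f x| <= D * `|h|.
Proof.
move=> df fD.
have dline (t : R) : is_derive t (1 : R) (fun t : R => f (t *: delta_mx ord0 j + x))
    (partial j f (t *: delta_mx ord0 j + x)).
  by apply/is_derive_line; apply/derivableP.
have [c _] := MVT_sym h dline; rewrite scale0r add0r => E.
by rewrite (addrC x) E normrM ler_wpM2r.
Qed.

(** The mean value theorem expresses the increment by the partial derivative at a
    nearby point; the latter is uniformly continuous, having compact support. *)
Lemma unif_diff_quotient (x0 : 'rV[R]_n) r f (j : 'I_n) (e : R) :
  (forall x, derivable f x (delta_mx ord0 j)) -> continuous (partial j f) ->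
  supp_in x0 r (partial j f) -> 0 < e ->
  exists2 d, 0 < d & forall h x, `|h| < d ->
    `|f (x + h *: delta_mx ord0 j) - f x - h * partial j f x| <= e * `|h|.
Proof.
move=> df cdf sdf e0.
have [d d0 dP] := unif_continuous_supp cdf sdf e0.
exists d => // h x hd.
have dline (t : R) : is_derive t (1 : R) (fun t : R => f (t *: delta_mx ord0 j + x))
    (partial j f (t *: delta_mx ord0 j + x)).
  by apply/is_derive_line; apply/derivableP.
have [c ch] := MVT_sym h dline; rewrite scale0r add0r => E.
rewrite (addrC x) E mulrC -mulrBr normrM mulrC ler_wpM2r//.
apply/ltW/dP; rewrite addrK normrZ.
have := ler_wpM2l (normr_ge0 c) (norm_delta_le1 j); rewrite mulr1.
by move=> /le_lt_trans; apply; exact: le_lt_trans hd.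
Qed.

End compact_support.

(** * Uniform approximation of continuous functions by smooth ones *)

Section density.
Context {R : realType}.

(** Translates of this bump by integers sum to 1, by telescoping. *)
Definition hat (t : R) : R := step (t + 1) - step t.

Lemma smooth1_hat (a b : R) : smooth1 (fun t => hat (a * t + b)).
Proof.
apply: smooth1_affine => k; rewrite /hat.
have -> : (fun t : R => step (t + 1) - step t) =
    (fun t => step (1 * t + 1)) + cst (-1) * step.
  by apply/funext => t; rewrite !fctE mul1r mulN1r.
apply: n_derivableD; first exact/n_derivable_affine/smooth_step.
by apply: n_derivableM; [exact: n_derivable_cst|exact: smooth_step].
Qed.

Lemma hat_ge0 t : 0 <= hat t.
Proof. by rewrite subr_ge0 step_homo// lerDl. Qed.

Lemma hat_neq0 t : hat t != 0 -> `|t| < 1.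
Proof.
move=> ht; rewrite ltr_norml; apply/andP; split; rewrite ltNge; apply: contra ht => t1.
  by rewrite /hat !step_le0 ?subrr//; lra.
by rewrite /hat !step_ge1 ?subrr//; lra.
Qed.

Lemma sum_hat (m : nat) t : 0 <= t <= m%:R ->
  \sum_(i < m.+1) hat (t - i%:R) = 1.
Proof.
move=> /andP[t0 tm].
have -> : \sum_(i < m.+1) hat (t - i%:R) = step (t + 1) - step (t - m%:R).
  elim: m {t0 tm} => [|m IH].
    by rewrite big_ord_recl big_ord0 addr0 subr0.
  rewrite big_ord_recr/= IH /hat.
  rewrite (_ : t - m.+1%:R + 1 = t - m%:R); first by ring.
  by rewrite -natr1; ring.
by rewrite step_ge1 ?step_le0 ?subr0//; lra.
Qed.

Variable n : nat.

(** Products of hats centred at the points of a grid form a smooth partition of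
    unity; sampling f on the grid gives the approximation, by uniform continuity
    of f. *)
Lemma smooth_dense (x0 : 'rV[R]_n) (r r' e : R) (f : 'rV[R]_n -> R) :
  0 <= r -> r < r' -> 0 < e -> continuous f -> supp_in x0 r f ->
  exists g : 'rV[R]_n -> R,
    [/\ smooth g, supp_in x0 r' g & forall x, `|g x - f x| <= e].
Proof.
move=> r0 rr' e0 cf fr.
have r'0 : 0 < r' by exact: le_lt_trans rr'.
have [d0 d00 d0P] := unif_continuous_supp cf fr e0.
(* The mesh is fine enough for uniform continuity and for the support to grow by
   at most r' - r. *)
pose d1 := Num.min d0 (r' - r).
have d10 : 0 < d1 by rewrite lt_min d00 subr_gt0.
have [m] := ltr_add_invr (divr_gt0 d10 (mulr_gt0 (ltr0n R 2) r'0)).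
rewrite add0r ltr_pdivlMr ?mulr_gt0// => md.
pose d := (m.+1%:R)^-1 * (2 * r').
have d_gt0 : 0 < d by rewrite !mulr_gt0// invr_gt0.
have dd0 : d < d0 by apply: lt_le_trans md _; rewrite ge_min lexx.
have ddr : d < r' - r by apply: lt_le_trans md _; rewrite ge_min lexx orbT.
have md' : m.+1%:R * d = 2 * r' by rewrite mulrA mulfV ?mul1r// pnatr_eq0.
(* tau rescales coordinate a so that the grid points become 0, ..., m + 1. *)
pose tau a (t : R) : R := d^-1 * t + d^-1 * (r' - x0 ord0 a).
pose b (a : 'I_n) (i : 'I_m.+2) (t : R) := hat (d^-1 * t + (d^-1 * (r' - x0 ord0 a) - i%:R)).
have bE a i t : b a i t = hat (tau a t - i%:R) by rewrite /b addrA.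
pose pt (s : {ffun 'I_n -> 'I_m.+2}) : 'rV[R]_n := \row_a (x0 ord0 a - r' + (s a)%:R * d).
pose B (s : {ffun 'I_n -> 'I_m.+2}) := tensor (fun a => b a (s a)).
have Bge0 s x : 0 <= B s x by apply: prodr_ge0 => a _; rewrite bE hat_ge0.
have Bsupp s x : B s x != 0 -> `|x - pt s| < d.
  move=> Bx; apply/row_norm_ltP => // a.
  have : b a (s a) (x ord0 a) != 0.
    by apply: contra Bx => bx; rewrite /B /tensor (bigD1 a)//= (eqP bx) mul0r.
  rewrite bE => /hat_neq0.
  rewrite -(ltr_pM2r d_gt0) mul1r -[X in _ * X < _](gtr0_norm d_gt0) -normrM.
  congr (`|_| < _); rewrite !mxE /tau; field.
  by rewrite gt_eqF.
have Bsum x : `|x - x0| <= r' -> \sum_s B s x = 1.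
  move=> xr; rewrite -(bigA_distr_bigA (fun a i => b a i (x ord0 a))).
  rewrite big1// => a _; under eq_bigr do rewrite bE.
  apply: sum_hat.
  have : `|x ord0 a - x0 ord0 a| <= r'.
    by apply: le_trans xr; have := coord_le_norm (x - x0) a; rewrite !mxE.
  rewrite ler_norml => /andP[x1 x2].
  have -> : tau a (x ord0 a) = (x ord0 a - x0 ord0 a + r') / d by rewrite /tau; ring.
  rewrite divr_ge0 ?(ltW d_gt0)//=; last lra.
  by rewrite ler_pdivrMr// md'; lra.
(* A hat not vanishing at x has its centre within d of x, and f vanishes at that
   centre if x is far away. *)
have far s x : r' < `|x - x0| -> f (pt s) * B s x = 0.
  move=> xr; apply/eqP; rewrite mulf_eq0; apply/negPn; rewrite negb_or; apply/negP.
  move=> /andP[/fr fpt /Bsupp Bx].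
  have : `|x - x0| < r'.
    rewrite -(subrK (pt s) x) -addrA (le_lt_trans (ler_normD _ _))//.
    by rewrite -(subrK r r') ltr_leD// (lt_trans Bx).
  by rewrite ltNge (ltW xr).
exists (fun x => \sum_s f (pt s) * B s x); split.
- apply: smooth_sum => s; apply: smoothZ; apply: smooth_tensor => a.
  exact: smooth1_hat.
- move=> x; apply: contraNT; rewrite -ltNge => xr.
  by rewrite big1// => s _; exact: far.
- move=> x; have [xr|xr] := leP `|x - x0| r'; last first.
    rewrite big1 ?sub0r; last by move=> s _; exact: far.
    by rewrite (supp_in_eq0 fr) ?oppr0 ?normr0 ?ltW// (lt_trans rr').
  rewrite -[f x]mulr1 -(Bsum _ xr) mulr_sumr -sumrB.
  apply: le_trans (ler_norm_sum _ _ _) _.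
  rewrite -[e]mulr1 -(Bsum _ xr) mulr_sumr ler_sum// => s _.
  rewrite -mulrBl normrM [`|B s x|]ger0_norm//.
  have [->|/Bsupp Bx] := eqVneq (B s x) 0; first by rewrite !mulr0.
  by rewrite ler_wpM2r// ltW// d0P// distrC (lt_trans Bx).
Qed.

End density.

(** * Limits of integrals and functions orthogonal to smooth ones *)

Section epsilon.
Context {R : realType}.

Lemma le_of_eps (x y K : R) : 0 <= K -> (forall e, 0 < e -> x <= y + e * K) -> x <= y.
Proof.
move=> K0 H; apply/ler_addgt0Pr => e e0.
have K1 : 0 < K + 1 by rewrite ltr_wpDl.
apply: le_trans (H (e / (K + 1)) _) _; first by rewrite divr_gt0.
by rewrite lerD2l mulrAC ler_pdivrMr// ler_wpM2l// ?ltW// ltrDl.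
Qed.

Lemma is_derive_le (F : R -> R) (t D : R) :
  (forall e, 0 < e -> exists2 d, 0 < d & forall h, `|h| < d ->
    `|F (h + t) - F t - h * D| <= e * `|h|) ->
  is_derive t (1 : R) F D.
Proof.
move=> H.
suff cv : (fun h => h^-1 *: ((F \o shift t) (h *: (1 : R)) - F t)) @ 0^' --> D.
  by apply: DeriveDef; [apply/cvg_ex; exists D|exact/cvg_lim].
apply/cvgrPdist_le => /= e e0; have [d d0 dP] := H e e0.
have h : \forall h \near (0:R)^', `|h| < d.
  by apply: nbhs_dnbhs; exact: (@nbhs0_lt R R).
have h' : \forall h \near (0:R)^', h != 0 by exact: nbhs_dnbhs_neq.
near=> k.
have k0 : k != 0 by near: k.
have kd : `|k| < d by near: k.
rewrite distrC /GRing.scale/= mulr1.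
rewrite -(ler_pM2r (_ : 0 < `|k|)) ?normr_gt0// -normrM mulrBl.
rewrite mulrAC mulVf// mul1r (mulrC D).
exact: dP.
Unshelve. all: by end_near. Qed.

End epsilon.

Section integral_limits.
Context {R : realType} {n : nat}.
Local Notation mu := (lebesgue_n R n).
Local Notation intg f := (mu.-integrable setT (EFin \o f)).
Local Notation meas f := (measurable_fun (setT : set (lebesgue_rV R n)) f).
Implicit Types f g : 'rV[R]_n -> R.

Lemma measurable_intg f : intg f -> meas f.
Proof. by move=> fi; apply/measurable_EFinP; exact: (measurable_int mu fi). Qed.

Lemma measurable_continuous f : continuous f -> meas f.
Proof.
by move=> cf; apply: measurable_continuous_rV => [|x _]; [exact: openT|exact: cf].
Qed.

Lemma Rintegral_dominated g (a_ : nat -> 'rV[R]_n -> R) (a : 'rV[R]_n -> R)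
    (S : R) :
  intg g -> (forall k, meas (a_ k)) -> (forall k x, `|a_ k x| <= S) ->
  (forall x, a_ k x @[k --> \oo] --> a x) ->
  \int[mu]_x (g x * a_ k x) @[k --> \oo] --> \int[mu]_x (g x * a x).
Proof.
move=> gi ma aS acv.
have ma' : meas a.
  exact: (measurable_fun_cvg ma (fun x _ => acv x)).
have aS' x : `|a x| <= S.
  have h : `|a_ k x| @[k --> \oo] --> `|a x| by exact: (cvg_norm (acv x)).
  rewrite -(cvg_lim _ h)//; apply: limr_le; first exact: cvgP h.
  by apply: nearW => k; exact: aS.
have mg := measurable_intg gi.
have gai k := integrable_mul_bounded gi (ma k) (aS k).
have gai' := integrable_mul_bounded gi ma' aS'.
apply: fine_cvg; rewrite fineK; last exact: integrable_fin_num.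
apply: (@dominated_cvg _ _ _ mu setT measurableT _ _ (fun x => (S%:E * `|(g x)%:E|)%E)).
- by move=> k; exact: (measurable_int mu (gai k)).
- move=> x _; apply: cvg_EFin; first by apply: nearW.
  exact: (cvgM (cvg_cst (g x)) (acv x)).
- by [].
- by apply: integrableZl => //; exact: integrable_abse.
- move=> k x _; rewrite /= lee_fin normrM mulrC ler_wpM2r//.
Qed.

Lemma integrable_ball_indic (x0 : 'rV[R]_n) (r : R) : intg (\1_(ball x0 r) : 'rV[R]_n -> R).
Proof.
apply: (@bounded_support_integrable _ _ _ x0 r 1).
- exact/measurable_indic/measurable_ball_rV.
- by move=> x; rewrite indicE; case: (_ \in _); rewrite ?normr1 ?normr0.
- by move=> x; rewrite indicE; case: (boolP (x \in _)) => [/set_mem//|]; rewrite eqxx.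
Qed.

Lemma mul_indicE (D : set 'rV[R]_n) (g : 'rV[R]_n -> R) :
  (fun x => \1_D x * g x) = g \_ D.
Proof.
by apply/funext => x; rewrite patchE indicE; case: (_ \in _); rewrite ?mul1r// mul0r.
Qed.

Lemma measurable_mul_indic (D : set 'rV[R]_n) (g : 'rV[R]_n -> R) :
  measurable (D : set (lebesgue_rV R n)) ->
  measurable_fun (D : set (lebesgue_rV R n)) g -> meas (fun x => \1_D x * g x).
Proof.
by move=> mD mg; rewrite mul_indicE; apply/(measurable_restrictT (D := (D : set (lebesgue_rV R n)))).
Qed.

Lemma measurable_eq0 f : meas f -> meas (fun x => (f x == 0)%:R : R).
Proof.
move=> mf; rewrite (_ : (fun x => _) = \1_(f @^-1` [set 0])).
  by apply: measurable_indic; rewrite -[X in measurable X]setTI; exact: mf.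
apply/funext => x; rewrite indicE; congr (nat_of_bool _)%:R.
by apply/eqP/idP => [fx|/set_mem//]; exact: mem_set.
Qed.

Lemma Rintegral_sum (I : Type) (s : seq I) (F : I -> 'rV[R]_n -> R) :
  (forall i, intg (F i)) ->
  intg (fun x => \sum_(i <- s) F i x) /\
  \int[mu]_x (\sum_(i <- s) F i x) = \sum_(i <- s) \int[mu]_x F i x.
Proof.
move=> iF; elim: s => [|i s [IHi IHs]].
  have -> : (fun x => \sum_(i <- [::]) F i x) = cst 0.
    by apply/funext => x; rewrite big_nil.
  by rewrite big_nil; split; [exact: integrable0|rewrite /Rintegral integral0].
have -> : (fun x => \sum_(i <- i :: s) F i x) = (fun x => F i x + \sum_(i <- s) F i x).
  by apply/funext => x; rewrite big_cons.
rewrite big_cons; split; first exact: (integrableD measurableT (iF i) IHi).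
by rewrite RintegralD// IHs.
Qed.

(** A uniform approximation of zeta changes the integral by at most the error
    times the norm of G in L^1. *)
Lemma orthogonal_continuous (G : 'rV[R]_n -> R) x0 (r : R) :
  intg G ->
  (forall psi r', 0 <= r' -> r' < r -> smooth psi -> supp_in x0 r' psi ->
    \int[mu]_x (G x * psi x) = 0) ->
  forall zeta r', 0 <= r' -> r' < r -> continuous zeta -> supp_in x0 r' zeta ->
    \int[mu]_x (G x * zeta x) = 0.
Proof.
move=> iG Gpsi zeta r' r'0 rr cz sz.
pose r1 := (r' + r) / 2.
have rr1 : r' < r1 by rewrite /r1; lra.
have r1r : r1 < r by rewrite /r1; lra.
have r10 : 0 <= r1 by lra.
have mz := measurable_continuous cz.
have [C C0 zC] := bounded_supp cz sz.
have NG0 : 0 <= \int[mu]_x `|G x| by exact: Rintegral_ge0.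
apply/eqP; rewrite -normr_eq0; apply/eqP/le_anti; rewrite normr_ge0 andbT.
apply: (le_of_eps NG0) => e e0; rewrite add0r.
have [psi [spsi sup psie]] := smooth_dense r'0 rr1 e0 cz sz.
have cpsi := smooth_continuous spsi; have mpsi := measurable_continuous cpsi.
have [C' _ psiC] := bounded_supp cpsi sup.
have i1 := integrable_mul_bounded iG mz zC.
have i2 := integrable_mul_bounded iG mpsi psiC.
have -> : \int[mu]_x (G x * zeta x) = \int[mu]_x (G x * (zeta x - psi x)).
  rewrite -[LHS]subr0 -[X in _ - X](Gpsi _ _ r10 r1r spsi sup) -RintegralB//.
  by apply: eq_Rintegral => x _; rewrite -!mulrBr.
apply: (le_Rintegral_mul iG) => [|x]; first exact: measurable_funB.
by rewrite distrC.
Qed.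

End integral_limits.

(** * Difference quotients and weak derivatives *)

Section weak_derivative.
Context {R : realType} {n : nat}.
Local Notation mu := (lebesgue_n R n).
Local Notation intg f := (mu.-integrable setT (EFin \o f)).
Local Notation meas f := (measurable_fun (setT : set (lebesgue_rV R n)) f).
Variables (V g : 'rV[R]_n -> R) (x0 : 'rV[R]_n) (r : R) (j : 'I_n).
Hypotheses (iV : intg V) (ig : intg g).
Hypothesis weakVg : forall phi r', smooth phi -> supp_in x0 r' phi -> r' < r ->
  \int[mu]_x (V x * partial j phi x) = - \int[mu]_x (g x * phi x).

Local Notation e_j := (delta_mx ord0 j : 'rV[R]_n).
Local Notation NV := (\int[mu]_x `|V x|).
Local Notation Ng := (\int[mu]_x `|g x|).
Implicit Types (phi psi zeta : 'rV[R]_n -> R) (h t e C : R).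

Let NV_ge0 : 0 <= NV. Proof. by apply: Rintegral_ge0. Qed.
Let Ng_ge0 : 0 <= Ng. Proof. by apply: Rintegral_ge0. Qed.

(** Not divided by h, so that all estimates below are linear in h. *)
Definition diff_pairing h zeta := \int[mu]_x ((V (x + h *: e_j) - V x) * zeta x).

Lemma supp_in_shift phi r' t : supp_in x0 r' phi ->
  supp_in x0 (r' + `|t|) (fun x => phi (x - t *: e_j)).
Proof.
move=> sphi x /sphi xt; rewrite -(subrK (t *: e_j) x) addrAC.
rewrite (le_trans (ler_normD _ _))// lerD//.
by rewrite normrZ -[leRHS]mulr1 ler_wpM2l// norm_delta_le1.
Qed.

(** Translation invariance moves the increment from V to zeta. *)
Lemma diff_pairingE h zeta C : meas zeta -> (forall x, `|zeta x| <= C) ->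
  diff_pairing h zeta =
  \int[mu]_x (V x * zeta (x - h *: e_j)) - \int[mu]_x (V x * zeta x).
Proof.
move=> mz zC; rewrite /diff_pairing.
have mzh : meas (fun x => zeta (x - h *: e_j)) by exact: measurable_fun_shift.
have iVz := integrable_mul_bounded iV mz zC.
have iVzh := integrable_mul_bounded iV mzh (fun x => zC (x - h *: e_j)).
rewrite -(Rintegral_shift (h *: e_j) iVzh) -RintegralB//.
  by apply: eq_Rintegral => x _; rewrite addrK mulrBl.
exact: integrable_shift iVzh.
Qed.

Lemma diff_quotient_pairing phi r' e : smooth phi -> supp_in x0 r' phi -> r' < r ->
  0 < e -> exists2 d, 0 < d & forall h, `|h| < d ->
    `|\int[mu]_x (V x * phi (x - h *: e_j)) - \int[mu]_x (V x * phi x)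
      - h * \int[mu]_x (g x * phi x)| <= e * NV * `|h|.
Proof.
move=> sphi sup rr e0.
have csp := smooth_continuous (smooth_partial j sphi).
have [d d0 dP] := unif_diff_quotient
  (fun x => smooth_derivable (j := j) (x := x) sphi) csp
  (partial_supp (j := j) sup) e0.
exists d => // h hd.
have [C1 _ C1P] := bounded_supp (smooth_continuous sphi) sup.
have [C2 _ C2P] := bounded_supp csp (partial_supp (j := j) sup).
have mp := measurable_continuous (smooth_continuous sphi).
have mph : meas (fun x => phi (x - h *: e_j)) by exact: measurable_fun_shift.
have mdp := measurable_continuous csp.
have i1 := integrable_mul_bounded iV mp C1P.
have i2 := integrable_mul_bounded iV mph (fun x => C1P (x - h *: e_j)).
have i3 := integrable_mul_bounded iV mdp C2P.
have i4 := @integrableZl _ _ _ _ _ measurableT h _ i3.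
have -> : h * \int[mu]_x (g x * phi x) = - \int[mu]_x (h * (V x * partial j phi x)).
  by rewrite RintegralZl// (weakVg sphi sup rr) mulrN opprK.
rewrite opprK -RintegralB// -RintegralD//; last exact: (integrableB measurableT i2 i1).
rewrite (@eq_Rintegral _ _ _ mu setT (fun x => V x * (phi (x - h *: e_j) - phi x + h * partial j phi x))); last first.
  by move=> x _; ring.
rewrite mulrAC; apply: (le_Rintegral_mul iV).
  apply: measurable_funD; first exact: measurable_funB.
  by apply: measurable_funM => //; exact: measurable_cst.
move=> x; have := dP (- h) x; rewrite normrN => /(_ hd).
by rewrite scaleNr mulNr opprK.
Qed.

(** The derivative in t falls on the test function, and the weak derivative turns
    it into a pairing with g.  Support control keeps the translated test function
    inside the ball where the weak identity is available. *)
Lemma is_derive_pairing phi r' t : smooth phi -> supp_in x0 r' phi ->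
  r' + `|t| < r ->
  is_derive t (1 : R) (fun t : R => \int[mu]_x (V x * phi (x - t *: e_j)))
    (\int[mu]_x (g x * phi (x - t *: e_j))).
Proof.
move=> sphi sup rt; apply: is_derive_le => e e0.
have NV1 : 0 < NV + 1 by rewrite ltr_wpDl.
have [d d0 dP] := diff_quotient_pairing (smooth_shift (- (t *: e_j)) sphi)
  (supp_in_shift (t := t) sup) rt (divr_gt0 e0 NV1).
exists d => // h hd; have := dP h hd.
rewrite (@eq_Rintegral _ _ _ mu setT (fun x => V x * phi (x - (h + t) *: e_j))); last first.
  by move=> x _; rewrite scalerDl opprD addrA.
move=> /le_trans; apply; rewrite ler_wpM2r// -mulrA ler_piMr ?(ltW e0)//.
by rewrite mulrC ler_pdivrMr// mul1r lerDl.
Qed.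

(** By [is_derive_pairing] and the mean value theorem in h, the pairing is h times
    the pairing of g with a translate of phi. *)
Lemma diff_pairing_smooth_le phi r' h C : smooth phi -> supp_in x0 r' phi ->
  0 < h -> r' + h < r -> (forall x, `|phi x| <= C) ->
  `|diff_pairing h phi| <= h * (C * Ng).
Proof.
move=> sphi sup h0 rh phiC.
have mp := measurable_continuous (smooth_continuous sphi).
rewrite (diff_pairingE h mp phiC).
have der c : c \in `[0, h] -> is_derive c (1 : R)
    (fun t : R => \int[mu]_x (V x * phi (x - t *: e_j)))
    (\int[mu]_x (g x * phi (x - c *: e_j))).
  rewrite in_itv/= => /andP[c0 ch]; apply: (is_derive_pairing sphi sup).
  by rewrite ger0_norm// (le_lt_trans _ rh)// lerD2l.
have [|c _] := MVT_segment (ltW h0) (fun c ch => der c (subset_itv_oo_cc ch)) _.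
  by apply: derivable_within_continuous => c /der[].
rewrite subr0 => E.
have E0 : \int[mu]_x (V x * phi (x - 0 *: e_j)) = \int[mu]_x (V x * phi x).
  by apply: eq_Rintegral => x _; rewrite scale0r subr0.
rewrite -E0 E normrM (gtr0_norm h0) mulrC ler_wpM2l ?(ltW h0)//.
apply: (le_Rintegral_mul ig) => [|x]; last exact: phiC.
exact: measurable_fun_shift.
Qed.

Lemma diff_pairingB h zeta psi C C' : meas zeta -> (forall x, `|zeta x| <= C) ->
  meas psi -> (forall x, `|psi x| <= C') ->
  diff_pairing h (fun x => zeta x - psi x) = diff_pairing h zeta - diff_pairing h psi.
Proof.
move=> mz zC mp pC; rewrite /diff_pairing.
have iD : intg (fun x => V (x + h *: e_j) - V x).
  exact: (integrableB measurableT (integrable_shift (h *: e_j) iV) iV).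
rewrite -RintegralB//; first by apply: eq_Rintegral => x _; rewrite mulrBr.
- exact: (integrable_mul_bounded iD mz zC).
- exact: (integrable_mul_bounded iD mp pC).
Qed.

(** The smooth bound passes to uniform limits.  Its point is uniformity in h: it
    bounds the difference quotients of V as functionals on continuous functions. *)
Lemma diff_pairing_le zeta r' r1 h C : continuous zeta -> supp_in x0 r' zeta ->
  0 <= r' -> r' < r1 -> 0 < h -> r1 + h < r -> (forall x, `|zeta x| <= C) ->
  `|diff_pairing h zeta| <= h * (C * Ng).
Proof.
move=> cz sz r'0 rr1 h0 rh zC.
have mz := measurable_continuous cz.
have iD : intg (fun x => V (x + h *: e_j) - V x).
  exact: (integrableB measurableT (integrable_shift (h *: e_j) iV) iV).
pose ND := \int[mu]_x `|V (x + h *: e_j) - V x|.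
have ND0 : 0 <= ND by apply: Rintegral_ge0.
apply: (@le_of_eps _ _ _ (h * Ng + ND)); first by rewrite addr_ge0// mulr_ge0// ltW.
move=> e e0; have [psi [spsi sup psie]] := smooth_dense r'0 rr1 e0 cz sz.
have psiC x : `|psi x| <= C + e.
  by rewrite -(subrK (zeta x) (psi x)) addrC (le_trans (ler_normD _ _))// lerD.
have mpsi := measurable_continuous (smooth_continuous spsi).
have -> : diff_pairing h zeta = diff_pairing h psi -
    diff_pairing h (fun x => psi x - zeta x).
  by rewrite (diff_pairingB h mpsi psiC mz zC) opprB addrC subrK.
apply: le_trans (ler_normB _ _) _.
rewrite mulrDr addrA lerD//.
  apply: le_trans (diff_pairing_smooth_le spsi sup h0 rh psiC) _.
  by rewrite mulrDl mulrDr mulrCA [e * (_ * _)]mulrCA.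
by apply: (le_Rintegral_mul iD _ psie); exact: measurable_funB.
Qed.

(** For smooth zeta this is the derivative at 0 of the pairing.  The uniform bound
    [diff_pairing_le] transfers it to continuous zeta. *)
Lemma diff_pairing_cvg zeta r' e : continuous zeta -> supp_in x0 r' zeta ->
  0 <= r' -> r' < r -> 0 < e -> exists2 d, 0 < d & forall h, 0 < h -> h < d ->
  `|diff_pairing h zeta - h * \int[mu]_x (g x * zeta x)| <= e * h.
Proof.
move=> cz sz r'0 rr e0.
pose r1 := (r' + r) / 2; pose r2 := (r1 + r) / 2.
have rr1 : r' < r1 by rewrite /r1; lra.
have r1r2 : r1 < r2 by rewrite /r2 /r1; lra.
have r2r : r2 < r by rewrite /r2 /r1; lra.
have r10 : 0 <= r1 by apply: le_trans r'0 (ltW _).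
(* The error collects the pairings of zeta - psi with the increment and with g, and
   the first-order error for psi. *)
pose K := Ng + NV + Ng + 1.
have K0 : 0 < K by rewrite /K ltr_wpDl// !addr_ge0.
have eK : 0 < e / K by rewrite divr_gt0.
have [psi [spsi sup psie]] := smooth_dense r'0 rr1 eK cz sz.
have cpsi := smooth_continuous spsi.
have mz := measurable_continuous cz.
have mpsi := measurable_continuous cpsi.
have [C _ zC] := bounded_supp cz sz.
have [C' _ psiC] := bounded_supp cpsi sup.
have sdiff : supp_in x0 r1 (fun x => zeta x - psi x).
  move=> x; have [/eqP ->|/sz zx _] := boolP (zeta x == 0).
    by rewrite sub0r oppr_eq0 => /sup.
  exact: le_trans zx (ltW rr1).
have cdiff : continuous (fun x => zeta x - psi x).
  by move=> x; exact: (continuousB (cz x) (cpsi x)).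
have [d d0 dP] := diff_quotient_pairing spsi sup (lt_trans r1r2 r2r) eK.
exists (Num.min d (r - r2)); first by rewrite lt_min d0 subr_gt0.
move=> h h0; rewrite lt_min => /andP[hd hr].
have A : `|diff_pairing h (fun x => zeta x - psi x)| <= h * ((e / K) * Ng).
  apply: (diff_pairing_le cdiff sdiff r10 r1r2 h0) => [|x]; first lra.
  by rewrite distrC.
have B := dP h; rewrite (gtr0_norm h0) in B; have {}B := B hd.
rewrite -(diff_pairingE h mpsi psiC) in B.
have igz := integrable_mul_bounded ig mz zC.
have igpsi := integrable_mul_bounded ig mpsi psiC.
have D : `|\int[mu]_x (g x * psi x) - \int[mu]_x (g x * zeta x)| <= (e / K) * Ng.
  rewrite -RintegralB// (@eq_Rintegral _ _ _ mu setT (fun x => g x * (psi x - zeta x))).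
    by apply: (le_Rintegral_mul ig _ psie); exact: measurable_funB.
  by move=> x _; rewrite mulrBr.
rewrite (diff_pairingB h mz zC mpsi psiC) in A.
set I1 := \int[mu]_x (g x * zeta x) in D *; set I2 := \int[mu]_x (g x * psi x) in B D *.
set P1 := diff_pairing h zeta in A *; set P2 := diff_pairing h psi in A B *.
have -> : P1 - h * I1 = (P1 - P2) + (P2 - h * I2) + h * (I2 - I1) by ring.
apply: le_trans (ler_normD _ _) _.
have : `|P1 - P2 + (P2 - h * I2)| <= h * (e / K * Ng) + e / K * NV * h.
  by apply: le_trans (ler_normD _ _) _; exact: lerD.
have : `|h * (I2 - I1)| <= h * (e / K * Ng).
  by rewrite normrM (gtr0_norm h0) ler_pM2l.
move=> H1 H2; apply: le_trans (lerD H2 H1) _.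
have -> : h * (e / K * Ng) + e / K * NV * h + h * (e / K * Ng) =
   (e / K * (K - 1)) * h by rewrite /K; ring.
rewrite ler_wpM2r ?(ltW h0)// -[leRHS](divfK (lt0r_neq0 K0)).
by rewrite ler_wpM2l ?(ltW eK)// gerBl.
Qed.

End weak_derivative.

(** * The truncations t / (1 + (k t)^2) *)

Section truncation.
Context {R : realType}.
Implicit Types s t k M : R.

Definition trunc k t : R := t / (1 + (k * t) ^+ 2).

(** The divided difference of [trunc]; on the diagonal it is its derivative. *)
Definition trunc_quot k s t : R :=
  (1 - k ^+ 2 * s * t) / ((1 + (k * s) ^+ 2) * (1 + (k * t) ^+ 2)).

Lemma trunc_den_gt0 k t : 0 < 1 + (k * t) ^+ 2.
Proof. by rewrite ltr_pwDl// sqr_ge0. Qed.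

Lemma trunc_quotE k s t : trunc k s - trunc k t = (s - t) * trunc_quot k s t.
Proof.
rewrite /trunc /trunc_quot; field.
by rewrite !gt_eqF ?trunc_den_gt0.
Qed.

Lemma trunc_le k t : 0 < k -> `|trunc k t| <= k^-1.
Proof.
move=> k0; rewrite /trunc normrM normfV (gtr0_norm (trunc_den_gt0 _ _)).
rewrite ler_pdivrMr ?trunc_den_gt0// -(ler_pM2l k0) mulrA mulfV ?gt_eqF// mul1r.
rewrite -(gtr0_norm k0) -normrM (gtr0_norm k0) ler_norml.
by apply/andP; split; nra.
Qed.

(** With a = k s and b = k t, the claim is |1 - a b| <= (1 + a^2) (1 + b^2), which
    follows from 2 |a b| <= a^2 + b^2. *)
Lemma trunc_quot_le1 k s t : `|trunc_quot k s t| <= 1.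
Proof.
have d0 : 0 < (1 + (k * s) ^+ 2) * (1 + (k * t) ^+ 2).
  by rewrite mulr_gt0// trunc_den_gt0.
rewrite /trunc_quot normrM normfV (gtr0_norm d0) ler_pdivrMr// mul1r.
set a := k * s; set b := k * t.
have -> : k ^+ 2 * s * t = a * b by rewrite /a /b; ring.
rewrite ler_norml; apply/andP; split.
  have : 0 <= (a - b) ^+ 2 by exact: sqr_ge0.
  have : 0 <= (a * b) ^+ 2 by exact: sqr_ge0.
  by nra.
have : 0 <= (a + b) ^+ 2 by exact: sqr_ge0.
have : 0 <= (a * b) ^+ 2 by exact: sqr_ge0.
by nra.
Qed.

Lemma trunc_quot_lip k s t M : `|s| <= M -> `|t| <= M ->
  `|trunc_quot k s t - trunc_quot k t t| <=
    k ^+ 2 * (k ^+ 2 * M ^+ 3 + 3 * M) * `|s - t|.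
Proof.
move=> sM tM; have M0 : 0 <= M by exact: le_trans sM.
have d1 := trunc_den_gt0 k s; have d2 := trunc_den_gt0 k t.
have -> : trunc_quot k s t - trunc_quot k t t =
    (k ^+ 2 * (k ^+ 2 * s * t ^+ 2 - s - 2 * t) * (s - t)) /
    ((1 + (k * s) ^+ 2) * (1 + (k * t) ^+ 2) ^+ 2).
  rewrite /trunc_quot; field.
  by rewrite !gt_eqF.
have D1 : 1 <= (1 + (k * s) ^+ 2) * (1 + (k * t) ^+ 2) ^+ 2.
  by rewrite mulr_ege1// ?exprn_ege1// lerDl sqr_ge0.
rewrite normrM normfV (ger0_norm (le_trans ler01 D1)).
rewrite ler_pdivrMr ?(lt_le_trans ltr01)//.
apply: (@le_trans _ _ (k ^+ 2 * (k ^+ 2 * M ^+ 3 + 3 * M) * `|s - t|)); last first.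
  rewrite ler_peMr// mulr_ge0// mulr_ge0 ?sqr_ge0// addr_ge0// mulr_ge0//.
    exact: sqr_ge0.
  exact: exprn_ge0.
rewrite normrM ler_wpM2r// normrM (ger0_norm (sqr_ge0 k)) ler_wpM2l ?sqr_ge0//.
have -> : 3 * M = M + 2 * M by ring.
rewrite addrA (le_trans (ler_normB _ _))// lerD//; last first.
  by rewrite normrM ger0_norm// ler_wpM2l.
rewrite (le_trans (ler_normB _ _))// lerD//.
rewrite -mulrA normrM (ger0_norm (sqr_ge0 k)) ler_wpM2l ?sqr_ge0//.
by rewrite normrM normrX [M ^+ 3]exprS ler_pM// ?exprn_ge0// lerXn2r.
Qed.

(** In the limit the derivative of the truncation selects the zero set. *)
Lemma trunc_quot_diag_cvg t :
  trunc_quot k%:R t t @[k --> \oo] --> ((t == 0)%:R : R).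
Proof.
have [->|t0] := eqVneq t 0.
  have -> : (fun k : nat => trunc_quot k%:R 0 0) = cst (1 : R).
    by apply/funext => k; rewrite /trunc_quot !mulr0 expr0n/= subr0 addr0 mulr1 divr1.
  exact: cvg_cst.
apply/cvgr0Pnorm_le => e e0.
have t2 : 0 < t ^+ 2 * e by rewrite mulr_gt0// exprn_even_gt0.
near=> k.
have d0 := trunc_den_gt0 k%:R t.
apply: (@le_trans _ _ (1 + (k%:R * t) ^+ 2)^-1).
  rewrite /trunc_quot normrM normfV (gtr0_norm (mulr_gt0 d0 d0)) invfM mulrA.
  rewrite ler_piMl ?invr_ge0 ?(ltW d0)// ler_pdivrMr// mul1r.
  have a2 : 0 <= (k%:R * t) ^+ 2 by exact: sqr_ge0.
  have -> : k%:R ^+ 2 * t * t = (k%:R * t) ^+ 2 by ring.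
  rewrite ler_norml; apply/andP; split; lra.
rewrite -[leRHS]invrK lef_pV2 ?posrE ?invr_gt0//.
have k1 : (t ^+ 2 * e)^-1 <= k%:R by near: k; exact: nbhs_infty_ger.
have k2 : (1 : R) <= k%:R by near: k; exact: nbhs_infty_ger.
apply: (@le_trans _ _ ((k%:R * t) ^+ 2)); last by rewrite lerDr.
have e1 : e^-1 = t ^+ 2 * (t ^+ 2 * e)^-1.
  by rewrite invfM mulrA mulfV ?mul1r// expf_neq0.
rewrite e1 exprMn mulrC ler_wpM2r ?sqr_ge0// (le_trans k1)// expr2.
by rewrite ler_peMl// (le_trans ler01).
Unshelve. all: by end_near. Qed.
Lemma continuous_trunc k : continuous (trunc k).
Proof.
move=> t.
have ct : (1 + (k * s) ^+ 2) @[s --> t] --> 1 + (k * t) ^+ 2.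
  have c1 : k * s @[s --> t] --> k * t by exact: (cvgM (cvg_cst k) cvg_id).
  have c2 : (k * s) ^+ 2 @[s --> t] --> (k * t) ^+ 2.
    by under eq_fun do rewrite expr2; rewrite expr2; exact: (cvgM c1 c1).
  exact: (cvgD (cvg_cst (1 : R)) c2).
exact: (cvgM cvg_id (cvgV (lt0r_neq0 (trunc_den_gt0 k t)) ct)).
Qed.

Lemma continuous_trunc_quot n k (a b : 'rV[R]_n -> R) x :
  {for x, continuous a} -> {for x, continuous b} ->
  {for x, continuous (fun y => trunc_quot k (a y) (b y))}.
Proof.
move=> ca cb.
have den c : {for x, continuous c} ->
    {for x, continuous (fun y : 'rV[R]_n => 1 + (k * c y) ^+ 2)}.
  move=> cc; have c1 : {for x, continuous (fun y => k * c y)}.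
    exact: (continuousM (@cst_continuous _ _ k x) cc).
  exact: (continuousD (@cst_continuous _ _ (1 : R) x) (continuousM c1 c1)).
have num : {for x, continuous (fun y => 1 - k ^+ 2 * a y * b y)}.
  apply: (continuousB (@cst_continuous _ _ (1 : R) x)).
  exact: (continuousM (continuousM (@cst_continuous _ _ (k ^+ 2) x) ca) cb).
apply: (continuousM num (continuousV _ (continuousM (den _ ca) (den _ cb)))).
by rewrite gt_eqF// mulr_gt0// trunc_den_gt0.
Qed.

End truncation.

(** * A weak derivative vanishes on the zero set *)

Section zero_level.
Context {R : realType} {n : nat}.
Local Notation mu := (lebesgue_n R n).
Local Notation intg f := (mu.-integrable setT (EFin \o f)).
Local Notation meas f := (measurable_fun (setT : set (lebesgue_rV R n)) f).
Variables (V g : 'rV[R]_n -> R) (x0 : 'rV[R]_n) (r : R) (j : 'I_n) (M : R).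
Hypotheses (iV : intg V) (ig : intg g) (VM : forall x, `|V x| <= M).
Hypothesis cV : forall x, `|x - x0| < r -> {for x, continuous V}.
Hypothesis weakVg : forall phi r', smooth phi -> supp_in x0 r' phi -> r' < r ->
  \int[mu]_x (V x * partial j phi x) = - \int[mu]_x (g x * phi x).

Local Notation e_j := (delta_mx ord0 j : 'rV[R]_n).
Local Notation Ng := (\int[mu]_x `|g x|).
Implicit Types (phi psi zeta : 'rV[R]_n -> R) (h t e C k : R).

Let Ng_ge0 : 0 <= Ng. Proof. by apply: Rintegral_ge0. Qed.
Let mV : meas V. Proof. exact: measurable_intg. Qed.

(** By [trunc_quotE] the left side pairs the increment of the truncation of V with
    phi.  Translation moves the increment to phi, which contributes h D, while
    the truncation is at most 1 / k and everything is supported in the ball. *)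
Lemma trunc_pairing_le phi r' h k D : 0 < k -> 0 < h -> r' + h < r ->
  smooth phi -> supp_in x0 r' phi -> (forall x, `|partial j phi x| <= D) ->
  `|diff_pairing V j h (fun x => trunc_quot k (V (x + h *: e_j)) (V x) * phi x)|
  <= h * (D * fine (mu (ball x0 r)) / k).
Proof.
move=> k0 h0 rh sphi sup phiD.
have D0 : 0 <= D by apply: le_trans (phiD x0).
have cphi := smooth_continuous sphi; have mp := measurable_continuous cphi.
have [C _ phiC] := bounded_supp cphi sup.
pose H x := trunc k (V x).
have mH : meas H.
  exact: (measurableT_comp (continuous_measurable_fun (continuous_trunc (k := k))) mV).
have HM x : `|H x| <= k^-1 by exact: trunc_le.
have iB := @integrable_ball_indic R n x0 r.
have iH : intg (fun x => \1_(ball x0 r) x * H x) by exact: integrable_mul_bounded iB mH HM.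
have r'r : r' < r by lra.
have supB x : `|x - x0| <= r' + h -> \1_(ball x0 r) x = 1 :> R.
  by move=> xr; rewrite indicE mem_set// -ball_normE/= distrC (le_lt_trans xr).
have mps : meas (fun x => phi (x - h *: e_j)) by exact: measurable_fun_shift.
have sps : supp_in x0 (r' + h) (fun x => phi (x - h *: e_j)).
  by have := supp_in_shift (j := j) (t := h) sup; rewrite (gtr0_norm h0).
pose A x := \1_(ball x0 r) x * (H x * phi (x - h *: e_j)).
pose B x := \1_(ball x0 r) x * (H x * phi x).
have iA : intg A.
  rewrite /A (_ : (fun x => _) = (fun x => (\1_(ball x0 r) x * H x) * phi (x - h *: e_j))).
    exact: (integrable_mul_bounded iH mps (fun x => phiC (x - h *: e_j))).
  by apply/funext => x; rewrite mulrA.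
have iB' : intg B.
  rewrite /B (_ : (fun x => _) = (fun x => (\1_(ball x0 r) x * H x) * phi x)).
    exact: (integrable_mul_bounded iH mp phiC).
  by apply/funext => x; rewrite mulrA.
have -> : diff_pairing V j h
    (fun x => trunc_quot k (V (x + h *: e_j)) (V x) * phi x) =
    \int[mu]_x (A (x + h *: e_j) - B x).
  apply: eq_Rintegral => x _; rewrite mulrA -trunc_quotE mulrBl /A /B addrK.
  have [->|/sup xr] := eqVneq (phi x) 0; first by rewrite !mulr0.
  rewrite !supB ?mul1r//; first by rewrite (le_trans xr)// lerDl ltW.
  rewrite addrAC (le_trans (ler_normD _ _))// lerD//.
  rewrite normrZ (gtr0_norm h0) ler_piMr ?(ltW h0)//; exact: norm_delta_le1.
rewrite RintegralB//; last exact: integrable_shift.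
rewrite Rintegral_shift// -RintegralB//.
rewrite (@eq_Rintegral _ _ _ mu setT (fun x => \1_(ball x0 r) x *
    (H x * (phi (x - h *: e_j) - phi x)))); last by move=> x _; rewrite /A /B; ring.
have -> : h * (D * fine (mu (ball x0 r)) / k) =
    (k^-1 * (D * h)) * \int[mu]_x `|\1_(ball x0 r) x : R|.
  rewrite (_ : \int[mu]_x _ = fine (mu (ball x0 r))); first by ring.
  rewrite -[RHS]mul1r -(Rintegral_cst mu (measurable_ball_rV x0 r)) [RHS]Rintegral_mkcond.
  apply: eq_Rintegral => x _; rewrite patchE indicE.
  case: ifPn => _; [exact: normr1|exact: normr0].
apply: (le_Rintegral_mul iB).
  exact: (measurable_funM mH (measurable_funB mps mp)).
move=> x; rewrite normrM ler_pM//.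
have := @increment_le R n phi j D (- h) x (fun y => smooth_derivable (j := j) (x := y) sphi) phiD.
by rewrite normrN scaleNr (gtr0_norm h0).
Qed.

(** Let h tend to 0 in [trunc_pairing_le]: the factor [trunc_quot] at
    (V (x + h e_j), V x) is uniformly close to its diagonal value, at a cost
    controlled by [diff_pairing_le]. *)
Lemma trunc_integral_le phi r' k D : 0 < k -> 0 <= r' -> r' < r ->
  smooth phi -> supp_in x0 r' phi -> (forall x, `|partial j phi x| <= D) ->
  `|\int[mu]_x (g x * (trunc_quot k (V x) (V x) * phi x))|
  <= D * fine (mu (ball x0 r)) / k.
Proof.
move=> k0 r'0 rr sphi sup phiD.
have M0 : 0 <= M by apply: le_trans (VM x0).
have cphi := smooth_continuous sphi.
have [C C0 phiC] := bounded_supp cphi sup.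
pose r1 := (r' + r) / 2; pose r2 := (r1 + r) / 2.
have rr1 : r' < r1 by rewrite /r1; lra.
have r1r2 : r1 < r2 by rewrite /r2 /r1; lra.
have r2r : r2 < r by rewrite /r2 /r1; lra.
pose zeta0 x := trunc_quot k (V x) (V x) * phi x.
pose zeta h x := trunc_quot k (V (x + h *: e_j)) (V x) * phi x.
have mphi := measurable_continuous cphi.
have s0 : supp_in x0 r' zeta0 by exact: supp_inM.
have c0 : continuous zeta0.
  apply: (continuousM_supp rr _ cphi sup) => x xr.
  by apply: continuous_trunc_quot; exact: cV.
have sh h : supp_in x0 r' (zeta h) by exact: supp_inM.
have ch h : 0 < h -> h < r - r1 -> continuous (zeta h).
  move=> h0 hr; apply: (continuousM_supp rr1 _ cphi sup) => x xr.
  apply: continuous_trunc_quot; last by apply: cV; rewrite (lt_trans xr)// (lt_trans r1r2).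
  apply: continuous_at_shift; apply: cV; rewrite addrAC.
  rewrite (le_lt_trans (ler_normD _ _))// normrZ (gtr0_norm h0).
  have := ler_wpM2l (ltW h0) (norm_delta_le1 j); lra.
pose L := k ^+ 2 * (k ^+ 2 * M ^+ 3 + 3 * M).
have L0 : 0 <= L.
  by rewrite mulr_ge0 ?sqr_ge0// addr_ge0// mulr_ge0 ?sqr_ge0 ?exprn_ge0.
apply: (@le_of_eps _ _ _ (L * C * Ng + 1)); first by rewrite addr_ge0// (mulr_ge0 (mulr_ge0 L0 C0) Ng_ge0).
move=> e e0.
have [d1 d10 d1P] := diff_pairing_cvg iV ig weakVg c0 s0 r'0 rr e0.
have [d2 d20 d2P] := unif_continuous_compact (@compact_dist_le _ _ x0 r')
  (fun x (xr : `|x - x0| <= r') => cV (le_lt_trans xr rr)) e0.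
pose h := Num.min (Num.min d1 d2) (r - r2) / 2.
have m0 : 0 < Num.min (Num.min d1 d2) (r - r2) by rewrite !lt_min d10 d20/= subr_gt0.
have h0 : 0 < h by rewrite /h divr_gt0.
have : h < Num.min (Num.min d1 d2) (r - r2) by rewrite /h; lra.
rewrite !lt_min => /andP[/andP[hd1 hd2] hr].
have hr1 : h < r - r1 by lra.
have rh : r' + h < r by lra.
have r2h : r1 + h < r by lra.
have P0 := d1P h h0 hd1.
have P1 := trunc_pairing_le k0 h0 rh sphi sup phiD.
rewrite -/(zeta h) in P1.
have dz x : `|zeta h x - zeta0 x| <= L * e * C.
  rewrite /zeta /zeta0 -mulrBl normrM.
  have [->|/sup xr] := eqVneq (phi x) 0; first by rewrite normr0 mulr0 (mulr_ge0 (mulr_ge0 L0 (ltW e0)) C0).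
  rewrite ler_pM//; apply: (le_trans (trunc_quot_lip k (VM _) (VM _))).
  rewrite ler_wpM2l// ltW// d2P// addrAC subrr add0r normrZ (gtr0_norm h0).
  apply: le_lt_trans hd2; rewrite ler_piMr ?(ltW h0)//; exact: norm_delta_le1.
have czd : continuous (fun x => zeta h x - zeta0 x).
  by move=> x; exact: (continuousB (ch h h0 hr1 x) (c0 x)).
have szd : supp_in x0 r' (fun x => zeta h x - zeta0 x).
  move=> x; have [/eqP E|/sup //] := boolP (phi x == 0).
  by rewrite /zeta /zeta0 E !mulr0 subrr eqxx.
have P2 := diff_pairing_le iV ig weakVg czd szd r'0 rr1 h0 r2h dz.
have zC x : `|zeta h x| <= C.
  by rewrite normrM -[C]mul1r ler_pM// trunc_quot_le1.
have z0C x : `|zeta0 x| <= C.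
  by rewrite normrM -[C]mul1r ler_pM// trunc_quot_le1.
have mz := measurable_continuous (ch h h0 hr1).
have mz0 := measurable_continuous c0.
rewrite (diff_pairingB j iV h mz zC mz0 z0C) in P2.
rewrite -/zeta0.
set I := \int[mu]_x (g x * zeta0 x) in P0 *.
rewrite -/(zeta0) in P0.
rewrite -(ler_pM2l h0) -[X in X * `|I|](gtr0_norm h0) -normrM.
set Q0 := diff_pairing V j h zeta0 in P0 P2.
set Q1 := diff_pairing V j h (zeta h) in P1 P2.
have -> : h * I = Q1 - (Q1 - Q0) - (Q0 - h * I) by ring.
apply: le_trans (ler_normB _ _) _.
have H1 : `|Q1 - (Q1 - Q0)| <= h * (D * fine (mu (ball x0 r)) / k) + h * (L * e * C * Ng).
  by apply: le_trans (ler_normB _ _) _; exact: lerD.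
apply: le_trans (lerD H1 P0) _.
by rewrite le_eqVlt; apply/orP; left; apply/eqP; ring.
Qed.

Lemma zero_level_smooth phi r' : 0 <= r' -> r' < r ->
  smooth phi -> supp_in x0 r' phi ->
  \int[mu]_x (g x * ((V x == 0)%:R * phi x)) = 0.
Proof.
move=> r'0 rr sphi sup.
have cphi := smooth_continuous sphi.
have mphi := measurable_continuous cphi.
have [C C0 phiC] := bounded_supp cphi sup.
have [D D0 phiD] := bounded_supp (smooth_continuous (smooth_partial j sphi))
  (partial_supp (j := j) sup).
pose a_ (i : nat) x := trunc_quot i%:R (V x) (V x) * phi x.
have c0 i : continuous (a_ i).
  apply: (continuousM_supp rr _ cphi sup) => x xr.
  by apply: continuous_trunc_quot; exact: cV.
have aC i x : `|a_ i x| <= C.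
  by rewrite normrM -[C]mul1r ler_pM// trunc_quot_le1.
have acv x : a_ i x @[i --> \oo] --> (V x == 0)%:R * phi x.
  have h1 : trunc_quot i%:R (V x) (V x) @[i --> \oo] --> ((V x == 0)%:R : R).
    exact: trunc_quot_diag_cvg.
  exact: (cvgM h1 (cvg_cst (phi x))).
have lim := Rintegral_dominated ig (fun i => measurable_continuous (c0 i)) aC acv.
set K := D * fine (mu (ball x0 r)).
have K0 : 0 <= K by rewrite mulr_ge0// fine_ge0.
have lim0 : \int[mu]_x (g x * a_ i x) @[i --> \oo] --> (0 : R).
  apply/cvgr0Pnorm_le => e e0; near=> i.
  have i0 : (0 : R) < i%:R by rewrite ltr0n; near: i; exact: nbhs_infty_gt.
  apply: le_trans (trunc_integral_le i0 r'0 rr sphi sup phiD) _.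
  rewrite -/K ler_pdivrMr// mulrC -ler_pdivrMr//.
  by near: i; exact: nbhs_infty_ger.
exact: (cvg_unique _ lim lim0).
Unshelve. all: by end_near. Qed.

(** A weak derivative of V vanishes almost everywhere on {V = 0}, expressed by
    duality. *)
Lemma zero_level_continuous zeta r' : 0 <= r' -> r' < r ->
  continuous zeta -> supp_in x0 r' zeta ->
  \int[mu]_x (g x * ((V x == 0)%:R * zeta x)) = 0.
Proof.
move=> r'0 rr cz sz.
have b1 x : `|(V x == 0)%:R : R| <= 1 by case: eqP => _; rewrite ?normr1 ?normr0.
have iG := integrable_mul_bounded ig (measurable_eq0 mV) b1.
under eq_Rintegral do rewrite mulrA.
apply: (orthogonal_continuous iG _ r'0 rr cz sz) => psi r1 r10 r1r spsi sup.
under eq_Rintegral do rewrite -mulrA.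
exact: zero_level_smooth r10 r1r spsi sup.
Qed.

End zero_level.

(** * Integration by parts and admissible test functions *)

Section test_functions.
Context {R : realType} {n : nat}.
Local Notation mu := (lebesgue_n R n).
Local Notation intg f := (mu.-integrable setT (EFin \o f)).
Local Notation meas f := (measurable_fun (setT : set (lebesgue_rV R n)) f).
Implicit Types (f g phi psi zeta : 'rV[R]_n -> R) (r : R).

Lemma restrict_supp (D : set 'rV[R]_n) f : (forall x, f x != 0 -> D x) -> f \_ D = f.
Proof.
move=> fD; apply/funext => x; rewrite patchE; case: ifPn => // /negP xD.
by apply/esym/eqP/negP => /negP /fD /mem_set.
Qed.

Lemma integrable_supp x0 r f : continuous f -> supp_in x0 r f -> intg f.
Proof.
move=> cf sf; have [C _ fC] := bounded_supp cf sf.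
apply: (@bounded_support_integrable _ _ _ x0 (r + 1) C _ fC).
  exact: measurable_continuous.
by move=> x /sf xr; rewrite -ball_normE/= distrC (le_lt_trans xr)// ltrDl.
Qed.

(** By translation invariance the difference quotient of f has integral 0, and it
    converges uniformly to the partial derivative, with supports in a fixed ball. *)
Lemma integral_partial0 x0 r f (j : 'I_n) :
  (forall x, derivable f x (delta_mx ord0 j)) -> continuous f ->
  continuous (partial j f) -> supp_in x0 r f -> \int[mu]_x partial j f x = 0.
Proof.
move=> df cf cdf sf.
have sdf := partial_supp (j := j) sf.
have iff := integrable_supp cf sf; have idf := integrable_supp cdf sdf.
(* For |h| < 1 the increments of f stay supported in this ball. *)
pose B : 'rV[R]_n -> R := \1_(ball x0 (r + 2)).
have iB : intg B by exact: integrable_ball_indic.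
have NB0 : 0 <= \int[mu]_x `|B x| by apply: Rintegral_ge0.
apply/eqP; rewrite -normr_eq0; apply/eqP/le_anti; rewrite normr_ge0 andbT.
apply: (le_of_eps NB0) => e e0; rewrite add0r.
have [d d0 dP] := unif_diff_quotient df cdf sdf e0.
pose h := Num.min d 1 / 2.
have h0 : 0 < h by rewrite divr_gt0// lt_min d0 ltr01.
have : h < Num.min d 1 by rewrite ltr_pdivrMr// ltr_pMr ?lt_min ?d0 ?ltr01// ltr1n.
rewrite lt_min => /andP[hd h1].
have nh : `|h| = h by rewrite gtr0_norm.
pose a := h *: (delta_mx ord0 j : 'rV[R]_n).
have ihdf := @integrableZl _ _ _ _ _ measurableT h _ idf.
have ifa := integrable_shift a iff.
have idiff := integrableB measurableT ifa iff.
have E : h * \int[mu]_x partial j f x =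
    - \int[mu]_x (B x * (f (x + a) - f x - h * partial j f x)).
  rewrite -RintegralZl// -[LHS]opprK; congr (- _).
  rewrite -[LHS]add0r -[X in X - _](subrr (\int[mu]_x f x)).
  rewrite -[X in X - _ - _](Rintegral_shift a iff) -RintegralB// -RintegralB//.
  apply: eq_Rintegral => x _.
  have [xB|xB] := boolP ((x : 'rV[R]_n) \in (ball x0 (r + 2) : set 'rV[R]_n)); first by rewrite /B indicE xB mul1r.
  rewrite /B indicE (negbTE xB) mul0r.
  have xr : r + 2 <= `|x - x0|.
    by rewrite leNgt; apply: contra xB => xr; rewrite mem_set// -ball_normE/= distrC.
  have ar : `|a| <= 1.
    by rewrite normrZ nh (le_trans (ler_wpM2l (ltW h0) (norm_delta_le1 j)))// mulr1 ltW.
  have xar : r < `|x + a - x0|.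
    have := ler_normB (x + a - x0) a.
    rewrite (_ : x + a - x0 - a = x - x0); last by rewrite addrAC addrK.
    by move=> H; clear -H xr ar; lra.
  have xr' : r < `|x - x0| by clear -xr; lra.
  by rewrite (supp_in_eq0 sf xar) (supp_in_eq0 sf xr') (supp_in_eq0 sdf xr') mulr0 !subr0.
rewrite -(ler_pM2l h0) -[X in X * `|_|]nh -normrM E normrN.
have -> : h * (e * \int[mu]_x `|B x|) = (e * h) * \int[mu]_x `|B x| by ring.
apply: (le_Rintegral_mul iB).
  apply: measurable_funB; last exact: (measurable_funM (measurable_cst h) (measurable_continuous cdf)).
  apply: measurable_funB; last exact: measurable_continuous.
  exact/measurable_fun_shift/measurable_continuous.
by move=> x; have := dP h x; rewrite nh; exact.
Qed.

Lemma integration_by_parts_rV x0 r phi psi (j : 'I_n) :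
  smooth phi -> supp_in x0 r phi -> smooth psi ->
  \int[mu]_x (phi x * partial j psi x) = - \int[mu]_x (partial j phi x * psi x).
Proof.
move=> sphi sup spsi.
have cphi := smooth_continuous sphi; have cpsi := smooth_continuous spsi.
have cdphi := smooth_continuous (smooth_partial j sphi).
have cdpsi := smooth_continuous (smooth_partial j spsi).
have dp x : derivable phi x (delta_mx ord0 j) by exact: smooth_derivable.
have dq x : derivable psi x (delta_mx ord0 j) by exact: smooth_derivable.
have E : partial j (phi * psi) = (fun x => phi x * partial j psi x + partial j phi x * psi x).
  apply/funext => x; rewrite /partial deriveM//.
  by congr (_ + _); rewrite [LHS]mulrC.
have c1 : continuous (fun x => phi x * partial j psi x).
  by move=> x; exact: (continuousM (cphi x) (cdpsi x)).
have c2 : continuous (fun x => partial j phi x * psi x).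
  by move=> x; exact: (continuousM (cdphi x) (cpsi x)).
have s1 : supp_in x0 r (fun x => phi x * partial j psi x).
  by move=> x; rewrite mulf_eq0 negb_or => /andP[/sup].
have s2 : supp_in x0 r (fun x => partial j phi x * psi x).
  by move=> x; rewrite mulf_eq0 negb_or => /andP[/(partial_supp sup)].
have i1 := integrable_supp c1 s1; have i2 := integrable_supp c2 s2.
have H : \int[mu]_x partial j (phi * psi) x = 0.
  apply: (@integral_partial0 x0 r).
  - by move=> x; exact: derivableM.
  - by move=> x; exact: (continuousM (cphi x) (cpsi x)).
  - by rewrite E => x; exact: (continuousD (c1 x) (c2 x)).
  - by move=> x; rewrite mulf_eq0 negb_or => /andP[/sup].
by move: H; rewrite E RintegralD// => /eqP; rewrite addr_eq0 => /eqP.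
Qed.

Lemma finite_norm_supp (x0 : 'rV[R]_n) r f (p : R) : 0 < p -> continuous f -> supp_in x0 r f ->
  finite_norm mu p%:E f.
Proof.
move=> p0 cf sf; have [C C0 fC] := bounded_supp cf sf.
have mf := measurable_continuous cf.
rewrite /finite_norm unlock; apply: poweR_lty.
have : intg (fun x => `|f x| `^ p).
  apply: (@bounded_support_integrable _ _ _ x0 (r + 1) (C `^ p)).
  - apply: (measurableT_comp (measurable_powR p)).
    exact: measurableT_comp.
  - by move=> x; rewrite ger0_norm ?powR_ge0// ge0_ler_powR ?nnegrE// ltW.
  - move=> x fx; have /sf xr : f x != 0.
      by apply: contra fx => /eqP ->; rewrite normr0 powR0// gt_eqF.
    by rewrite -ball_normE/= distrC (le_lt_trans xr)// ltrDl.
move=> /integrableP[_]; apply: le_lt_trans.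
rewrite le_eqVlt; apply/orP; left; apply/eqP/eq_integral => x _.
by rewrite /= [X in _ = X%:E]ger0_norm// powR_ge0.
Qed.

(** Makes smooth functions supported in a ball of Omega admissible in the weak
    formulation: integration by parts identifies their weak gradient, and they
    approximate themselves. *)
Lemma sobolev0_supp (Omega : set 'rV[R]_n) (x0 : 'rV[R]_n) r r' phi (p : R) :
  open Omega -> 0 < p -> ball x0 r `<=` Omega -> r' < r ->
  smooth phi -> supp_in x0 r' phi ->
  sobolev0 Omega p phi (fun j => partial j phi).
Proof.
move=> oO p0 BO rr sphi sup.
have inO f : supp_in x0 r' f -> forall x, f x != 0 -> Omega x.
  by move=> sf x /sf xr; apply: BO; rewrite -ball_normE/= distrC (le_lt_trans xr).
have inL f : continuous f -> supp_in x0 r' f -> in_Lp Omega p f.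
  move=> cf sf; split; first exact/measurable_funTS/measurable_continuous.
  by rewrite restrict_supp; [exact: (finite_norm_supp p0 cf sf)|exact: inO].
have cphi := smooth_continuous sphi.
have cd j := smooth_continuous (smooth_partial j sphi).
have sd j := partial_supp (j := j) sup.
have Lp0 f (e : R) : 0 < e -> (Lp_dist Omega p f f < e%:E)%E.
  move=> e0; rewrite /Lp_dist (_ : _ \o _ = cst 0%E) ?Lnorm0 ?lte_fin//.
    by rewrite eqe gt_eqF.
  by apply/funext => x /=; rewrite patchE /= subrr; case: ifP.
split.
  split; first exact: inL.
  move=> j; split; first exact: inL.
  move=> psi [spsi _ _].
  have conv f : supp_in x0 r' f -> intg f -> (\int[mu]_(x in Omega) (f x)%:E = (\int[mu]_x f x)%:E)%E.
    move=> sf fi; rewrite [RHS]fineK; last exact: integrable_fin_num.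
    rewrite integral_mkcond; apply: eq_integral => x _.
    rewrite patchE; case: ifPn => // xO.
    suff -> : f x = 0 by [].
    by apply/eqP; apply: contraNT xO => /(inO _ sf)/mem_set.
  have cpsi := smooth_continuous spsi.
  have cdpsi := smooth_continuous (smooth_partial j spsi).
  have s1 : supp_in x0 r' (fun x => phi x * partial j psi x).
    by move=> x; rewrite mulf_eq0 negb_or => /andP[/sup].
  have s2 : supp_in x0 r' (fun x => partial j phi x * psi x).
    by move=> x; rewrite mulf_eq0 negb_or => /andP[/sd].
  rewrite !conv//.
  - by rewrite (integration_by_parts_rV _ sphi sup spsi).
  - apply: (integrable_supp _ s2) => x; exact: (continuousM (cd j x) (cpsi x)).
  - apply: (integrable_supp _ s1) => x; exact: (continuousM (cphi x) (cdpsi x)).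
move=> e e0; exists phi; split; [|exact: Lp0|by move=> j; exact: Lp0].
have [s1 s2 s3] := test_function_supp sphi sup rr.
by split => //; exact: subset_trans s3 BO.
Qed.

End test_functions.

(** * Continuity of the flux, tent functions, square-integrability on balls *)

Section flux.
Context {R : realType} {n N : nat}.

Lemma continuous_at_C1 (Omega : set 'rV[R]_n) (v : 'rV[R]_n -> R) (j : 'I_n) x :
  open Omega -> C1_closure Omega v -> Omega x -> {for x, continuous (partial j v)}.
Proof.
move=> oO [_ /(_ j)[_ [g cg vg]]] Ox.
have : {in Omega, continuous g}.
  rewrite -continuous_open_subspace//.
  by apply: continuous_subspaceW cg; exact: subset_closure.
move=> /(_ x (mem_set Ox)) cgx.
have h : \forall y \near x, g y = partial j v y.
  by apply: filterS (open_nbhs_nbhs (conj oO Ox)) => y Oy; rewrite vg.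
rewrite /prop_for /continuous_at vg//.
exact: (cvg_trans (near_eq_cvg h) cgx).
Qed.

Lemma continuous_sum_at (I : Type) (s : seq I) (f : I -> 'rV[R]_n -> R) x :
  (forall i, {for x, continuous (f i)}) -> {for x, continuous (fun y => \sum_(i <- s) f i y)}.
Proof.
move=> cf; elim: s => [|i s IH].
  rewrite (_ : (fun y => _) = cst 0); first exact: cst_continuous.
  by apply/funext => y; rewrite big_nil.
rewrite (_ : (fun y => _) = (fun y => f i y + \sum_(i <- s) f i y)).
  exact: (continuousD (cf i) IH).
by apply/funext => y; rewrite big_cons.
Qed.

Lemma coord_le_frobenius (A : 'M[R]_(N, n)) l j : `|A l j| <= frobenius A.
Proof.
rewrite -sqrtr_sqr; apply: ler_wsqrtr.
rewrite (bigD1 l)//= (bigD1 j)//= -addrA lerDl.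
apply: addr_ge0; first by apply: sumr_ge0 => ? _; exact: sqr_ge0.
by apply: sumr_ge0 => ? _; apply: sumr_ge0 => ? _; exact: sqr_ge0.
Qed.

(** Where Du is nonzero this is continuity of powers of a positive base; where it
    vanishes, the flux is at most |Du|^(p-1) and p > 1. *)
Lemma continuous_p_flux (Omega : set 'rV[R]_n) (u : 'rV[R]_n -> 'rV[R]_N) (p : R) l j x :
  open Omega -> 1 < p -> (forall l, C1_closure Omega (fun y => u y ord0 l)) ->
  Omega x -> {for x, continuous (fun y => p_flux p u y l j)}.
Proof.
move=> oO p1 uC Ox.
pose D l j y := partial j (fun y => u y ord0 l) y.
have cD l' j' : {for x, continuous (D l' j')} by exact: (continuous_at_C1 (j := j') oO (uC l') Ox).
pose fr y := frobenius (Dmx u y).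
have cfr : {for x, continuous fr}.
  have c2 : {for x, continuous (fun y => \sum_l \sum_j D l j y ^+ 2)}.
    apply: continuous_sum_at => l'; apply: continuous_sum_at => j'.
    exact: (continuousM (cD l' j') (cD l' j')).
  have -> : fr = Num.sqrt \o (fun y => \sum_l \sum_j D l j y ^+ 2).
    apply/funext => y; rewrite /fr /frobenius /=; congr Num.sqrt.
    by apply: eq_bigr => l' _; apply: eq_bigr => j' _; rewrite mxE.
  exact: (continuous_comp c2 (@sqrt_continuous R _)).
have -> : (fun y => p_flux p u y l j) = (fun y => fr y `^ (p - 2) * D l j y).
  by apply/funext => y; rewrite /p_flux !mxE.
have fr_ge0 y : 0 <= fr y by exact: sqrtr_ge0.
have Dfr y : `|D l j y| <= fr y.
  by have := coord_le_frobenius (Dmx u y) l j; rewrite mxE.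
have [fx0|fx0] := eqVneq (fr x) 0; last first.
  have cp : {for fr x, continuous (fun a : R => a `^ (p - 2))}.
    apply/differentiable_continuous/derivable1_diffP/derivable_powR.
    by rewrite in_itv/= andbT lt_neqAle eq_sym fx0 fr_ge0.
  exact: (continuousM (continuous_comp cfr cp) (cD l j)).
have Dx0 : D l j x = 0.
  by apply/eqP; rewrite -normr_eq0; apply/eqP/le_anti; rewrite normr_ge0 andbT -fx0.
have E : fr x `^ (p - 2) * D l j x = 0 by rewrite [X in _ * X]Dx0 mulr0.
suff H : (fr y `^ (p - 2) * D l j y) @[y --> x] --> (0 : R).
  by move: H; rewrite -[X in _ --> X]E.
have p10 : 0 < p - 1 by rewrite subr_gt0.
apply/(@cvgr0Pnorm_le _ _ _ (nbhs x) (nbhs_filter x)) => e e0.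
pose d := e `^ ((p - 1)^-1).
have d0 : 0 < d by exact: powR_gt0.
have h : \forall y \near x, fr y < d.
  have : \forall y \near x, `|fr x - fr y| < d.
    by move/cvgrPdist_lt : cfr => /(_ _ d0).
  by apply: filterS => y; rewrite fx0 sub0r normrN ger0_norm.
apply: (@filterS _ (nbhs x) (nbhs_filter x) _ _ _ h) => y yd.
have [y0|y0] := eqVneq (fr y) 0.
  have -> : D l j y = 0 by apply/eqP; rewrite -normr_eq0; apply/eqP/le_anti; rewrite normr_ge0 andbT -y0.
  by rewrite mulr0 normr0 ltW.
rewrite normrM (ger0_norm (powR_ge0 _ _)).
apply: (@le_trans _ _ (fr y `^ (p - 2) * fr y)).
  by rewrite ler_wpM2l// powR_ge0.
have -> : fr y `^ (p - 2) * fr y = fr y `^ (p - 1).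
  rewrite -[X in _ * X](powRr1 (fr_ge0 y)) -powRD; last by rewrite y0 implybT.
  by congr (_ `^ _); ring.
have -> : e = d `^ (p - 1).
  by rewrite /d -powRrM mulVf ?powRr1 ?ltW// gt_eqF.
by rewrite ge0_ler_powR ?nnegrE ?(ltW p10)// ltW.
Qed.

Lemma p_flux_eq0 (u : 'rV[R]_n -> 'rV[R]_N) (p : R) x l j : Dmx u x = 0 -> p_flux p u x l j = 0.
Proof. by rewrite /p_flux => ->; rewrite scaler0 mxE. Qed.

End flux.

Section tent.
Context {R : realType} {n : nat}.
Local Notation mu := (lebesgue_n R n).
Local Notation intg f := (mu.-integrable setT (EFin \o f)).

Definition tent (x0 : 'rV[R]_n) (r : R) (x : 'rV[R]_n) : R := Num.max 0 (r - `|x - x0|).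

Lemma continuous_tent x0 r : continuous (tent x0 r).
Proof.
move=> x; have c : {for x, continuous (fun y : 'rV[R]_n => r - `|y - x0|)}.
  exact: (continuousB (@cst_continuous _ _ r x) (@continuous_dist _ _ x0 x)).
exact: (continuous_max (@cst_continuous _ _ (0 : R) x) c).
Qed.

Lemma supp_tent x0 r : supp_in x0 r (tent x0 r).
Proof.
move=> x; apply: contraNT; rewrite -ltNge => xr; apply/eqP/max_idPl.
by rewrite subr_le0 ltW.
Qed.

Lemma tent_gt0 x0 r x : `|x - x0| < r -> 0 < tent x0 r x.
Proof. by move=> xr; rewrite /tent lt_max subr_gt0 xr orbT. Qed.

Lemma tent_ge0 x0 r x : 0 <= tent x0 r x.
Proof. by rewrite /tent le_max lexx. Qed.

Lemma tent_ge x0 r x : r - `|x - x0| <= tent x0 r x.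
Proof. by rewrite /tent le_max lexx orbT. Qed.

(** On a set of finite measure, |g| <= 1 + g^2. *)
Lemma integrable_L2_ball (g : 'rV[R]_n -> R) x0 (r : R) :
  in_Lp (ball x0 r) 2 g -> intg (fun x => \1_(ball x0 r) x * g x).
Proof.
move=> [mg gfin].
rewrite -mul_indicE in gfin; set f := (fun x => _) in gfin *.
have mf : measurable_fun (setT : set (lebesgue_rV R n)) f.
  by apply: measurable_mul_indic => //; exact: measurable_ball_rV.
have fL : f \in Lfun mu 2%:E.
  by rewrite inE; apply/andP; split; rewrite inE/=.
have i2 := Lfun2_integrable_sqr fL.
have iB := @integrable_ball_indic R n x0 r.
apply: (le_integrable measurableT _ _ (integrableD measurableT iB i2)).
  exact/measurable_EFinP.
move=> x _; rewrite /= lee_fin.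
rewrite [leRHS]ger0_norm; last first.
  by rewrite addr_ge0 ?sqr_ge0// indicE; case: (_ \in _).
rewrite /f indicE; case: (_ \in _); last by rewrite !mul0r normr0 expr0n/= addr0.
rewrite !mul1r -(real_normK (num_real (g x))).
have := normr_ge0 (g x); set a := `|g x| => a0.
rewrite (_ : (nat_of_bool true)%:R = 1)//.
by have := sqr_ge0 (a - 1); nra.
Qed.

End tent.

(** * The scalar equation on a ball *)

Section balls.
Context {R : realType} {n : nat}.
Local Notation mu := (lebesgue_n R n).
Local Notation intg f := (mu.-integrable setT (EFin \o f)).
Local Notation meas f := (measurable_fun (setT : set (lebesgue_rV R n)) f).

Lemma integral_mul_indic (D : set 'rV[R]_n) (a b : 'rV[R]_n -> R) :
  (\int[mu]_(x in D) (a x * b x)%:E = \int[mu]_x (\1_D x * a x * b x)%:E)%E.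
Proof.
rewrite integral_mkcond; apply: eq_integral => x _; rewrite patchE indicE.
by case: (_ \in _); rewrite ?mul1r// !mul0r.
Qed.

Lemma bounded_on_ball (x0 : 'rV[R]_n) r (V : 'rV[R]_n -> R) :
  (forall x, `|x - x0| <= r -> {for x, continuous V}) ->
  exists M, forall x, `|\1_(ball x0 r) x * V x| <= M.
Proof.
move=> cV.
have cV' : {within [set x | `|x - x0| <= r], continuous V}.
  by apply: continuous_in_subspaceT => x /set_mem; exact: cV.
have /compact_bounded[M [_ MP]] := continuous_compact cV' (@compact_dist_le _ _ x0 r).
exists (`|M| + 1) => x.
have M1 : M < `|M| + 1 by rewrite (le_lt_trans (ler_norm M))// ltrDl.
rewrite indicE; case: (boolP (x \in _)) => [/set_mem xB|_]; last first.
  by rewrite mul0r normr0 addr_ge0.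
rewrite mul1r; apply: MP => //; exists x => //=.
by move: xB; rewrite -ball_normE/= distrC => /ltW.
Qed.

Lemma continuous_at_mul_indic (x0 : 'rV[R]_n) r (V : 'rV[R]_n -> R) x :
  `|x - x0| < r -> {for x, continuous V} ->
  {for x, continuous (fun x => \1_(ball x0 r) x * V x)}.
Proof.
move=> xr cV; have h : \forall y \near x, V y = \1_(ball x0 r) y * V y.
  have h : \forall y \near x, `|y - x0| < r by exact: (@continuous_dist _ _ x0 x _ (lt_nbhsl xr)).
  apply: (@filterS _ (nbhs x) (nbhs_filter x) _ _ _ h) => y yr.
  by rewrite indicE mem_set ?mul1r// -ball_normE/= distrC.
rewrite /prop_for /continuous_at -(nbhs_singleton h).
exact: (cvg_trans (near_eq_cvg h) cV).
Qed.

Lemma null_of_integral0 (F : 'rV[R]_n -> R) : intg F -> (forall x, 0 <= F x) ->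
  \int[mu]_x F x = 0 -> mu [set x | F x != 0] = 0%E.
Proof.
move=> iF F0 F00.
have mF : measurable_fun (setT : set (lebesgue_rV R n)) (EFin \o F) := measurable_int mu iF.
have : (\int[mu]_x `|(EFin \o F) x| = 0)%E.
  transitivity (\int[mu]_x (F x)%:E)%E.
    by apply: eq_integral => x _; rewrite /= ger0_norm.
  have := integrable_fin_num measurableT iF; move=> /fineK <-.
  by rewrite -[fine _]/(\int[mu]_x F x) F00.
move=> /(ae_eq_integral_abs mu measurableT mF)[A [mA A0 FA]].
apply/eqP; rewrite eq_le measure_ge0 andbT -A0.
apply: le_mu_ext => x /= Fx; apply: FA => /= h.
by move: (h Logic.I) => [] /eqP; rewrite (negbTE Fx).
Qed.

End balls.

Section local.
Context {R : realType} {n N : nat}.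
Local Notation mu := (lebesgue_n R n).
Local Notation intg f := (mu.-integrable setT (EFin \o f)).
Local Notation meas f := (measurable_fun (setT : set (lebesgue_rV R n)) f).

Variables (p : R) (Omega : set 'rV[R]_n) (f : 'rV[R]_n -> 'rV[R]_N -> 'rV[R]_N)
  (u : 'rV[R]_n -> 'rV[R]_N).

(** The equation tested with phi in component l0 and 0 in the others. *)
Lemma scalar_equation (l0 : 'I_N) x0 r r' phi :
  1 < p -> open Omega -> weak_solution Omega p f u ->
  ball x0 r `<=` Omega -> r' < r -> smooth phi -> supp_in x0 r' phi ->
  intg (fun x => \1_Omega x * f x (u x) ord0 l0 * phi x) /\
  (\int[mu]_x (\1_Omega x * f x (u x) ord0 l0 * phi x)%:E =
   \int[mu]_x (\sum_j \1_(ball x0 r) x * p_flux p u x l0 j * partial j phi x)%:E)%E.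
Proof.
move=> p1 oO [_ sol] BO rr sphi sup.
pose Phi x : 'rV[R]_N := \row_l (if l == l0 then phi x else 0).
pose DPhi x : 'M[R]_(N, n) := \matrix_(l, j) (if l == l0 then partial j phi x else 0).
have p0 : 0 < p by apply: lt_trans p1.
have sPhi : sobolev0_vec Omega p Phi DPhi.
  move=> l; have [ll|ll] := eqVneq l l0.
    rewrite (_ : (fun x => Phi x ord0 l) = phi); last first.
      by apply/funext => x; rewrite mxE ll eqxx.
    rewrite (_ : (fun j x => DPhi x l j) = (fun j => partial j phi)); last first.
      by apply/funext => j; apply/funext => x; rewrite mxE ll eqxx.
    exact: (sobolev0_supp oO p0 BO rr sphi sup).
  rewrite (_ : (fun x => Phi x ord0 l) = (fun=> 0)); last first.
    by apply/funext => x; rewrite mxE (negbTE ll).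
  rewrite (_ : (fun j x => DPhi x l j) = (fun j => partial j (fun=> 0))); last first.
    by apply/funext => j; apply/funext => x; rewrite mxE (negbTE ll) /partial derive_cst.
  have s0 : smooth (fun _ : 'rV[R]_n => 0 : R) by exact: smooth_cst.
  have sup0 : supp_in x0 r' (fun=> 0) by move=> x; rewrite eqxx.
  exact: (sobolev0_supp oO p0 BO rr s0 sup0).
have [iF E] := sol _ _ sPhi.
have vE x : vdot (f x (u x)) (Phi x) = f x (u x) ord0 l0 * phi x.
  rewrite /vdot (bigD1 l0)//= big1 ?addr0 ?mxE ?eqxx//.
  by move=> l /negbTE ll; rewrite mxE ll mulr0.
have mE x : mxdot (p_flux p u x) (DPhi x) = \sum_j p_flux p u x l0 j * partial j phi x.
  rewrite /mxdot (bigD1 l0)//= [X in _ + X]big1 ?addr0.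
    by apply: eq_bigr => j _; rewrite [X in _ * X]mxE eqxx.
  by move=> l /negbTE ll; rewrite big1// => j _; rewrite [X in _ * X]mxE ll mulr0.
have mO := measurable_open_rV oO.
split.
  move: iF => /(integrable_mkcond _ mO); congr (is_true (_.-integrable _ _)).
  apply/funext => x; rewrite patchE /= vE indicE.
  by case: (_ \in _); rewrite ?mul1r// !mul0r.
rewrite -integral_mul_indic.
transitivity (\int[mu]_(x in Omega) (mxdot (p_flux p u x) (DPhi x))%:E)%E.
  by rewrite E; apply: eq_integral => x _; rewrite vE.
rewrite integral_mkcond; apply: eq_integral => x _; rewrite patchE mE indicE.
case: (boolP (x \in _)) => [/set_mem Ox|xO]; last first.
  rewrite big1// => j _; rewrite (_ : (x \in _) = false) ?mul0r//.
  by apply/negP => /set_mem /BO xO'; apply: (negP xO); exact: mem_set.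
congr EFin; apply: eq_bigr => j _.
case: (boolP ((x : 'rV[R]_n) \in (ball x0 r : set 'rV[R]_n))) => xB; first by rewrite mul1r.
rewrite (supp_in_eq0 (partial_supp (j := j) sup)) ?mulr0//.
rewrite ltNge; apply: contra xB => xr; rewrite mem_set// -ball_normE/= distrC.
exact: le_lt_trans rr.
Qed.

End local.

(** * The critical set *)

Section critical.
Context {R : realType} {n N : nat}.
Local Notation mu := (lebesgue_n R n).
Local Notation intg f := (mu.-integrable setT (EFin \o f)).
Local Notation meas f := (measurable_fun (setT : set (lebesgue_rV R n)) f).

(** The weak formulation provides the integrability of F times a test function only;
    dividing by a test function that is at least rho / 2 on the smaller ball gives
    that of F there. *)
Lemma local_integrability (F : 'rV[R]_n -> R) (x0 : 'rV[R]_n) (r rho : R) :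
  0 < rho -> 3 * rho < r ->
  (forall psi r', r' < r -> smooth psi -> supp_in x0 r' psi -> intg (fun x => F x * psi x)) ->
  intg (fun x => \1_(ball x0 rho) x * F x).
Proof.
move=> rho0 rr Fi.
have [|||psi [spsi sup psie]] := @smooth_dense R n x0 (2 * rho) (3 * rho) (rho / 2)
  (tent x0 (2 * rho)) _ _ _ (@continuous_tent _ _ x0 _) (@supp_tent _ _ x0 _).
- by rewrite mulr_ge0// ltW.
- lra.
- by rewrite divr_gt0.
have cpsi := smooth_continuous spsi.
have psi_ge x : `|x - x0| < rho -> rho / 2 <= psi x.
  move=> xr; have := tent_ge x0 (2 * rho) x; have := psie x.
  by rewrite ler_norml => /andP[]; lra.
pose w x : R := (Num.max (psi x) (rho / 2))^-1.
have den x : rho / 2 <= Num.max (psi x) (rho / 2) by rewrite le_max lexx orbT.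
have den0 x : 0 < Num.max (psi x) (rho / 2) by apply: lt_le_trans (den x); rewrite divr_gt0.
have cw : continuous w.
  move=> x; have c : {for x, continuous (fun y => Num.max (psi y) (rho / 2))}.
    exact: (continuous_max (cpsi x) (@cst_continuous _ _ (rho / 2) x)).
  have d0 : Num.max (psi x) (rho / 2) != 0 by rewrite gt_eqF.
  exact: (cvgV d0 c).
have mh : meas (fun x => \1_(ball x0 rho) x * w x).
  apply: measurable_mul_indic; first exact: measurable_ball_rV.
  exact/measurable_funTS/measurable_continuous.
have hb x : `|\1_(ball x0 rho) x * w x| <= (rho / 2)^-1.
  rewrite normrM [leRHS](_ : _ = 1 * (rho / 2)^-1) ?mul1r// -[leRHS]mul1r ler_pM//.
    by rewrite indicE; case: (_ \in _); rewrite ?normr1 ?normr0.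
  rewrite /w gtr0_norm ?invr_gt0// lef_pV2// posrE//.
  by rewrite divr_gt0.
have := integrable_mul_bounded (Fi _ _ rr spsi sup) mh hb.
congr (is_true (_.-integrable _ _)); apply/funext => x /=; congr EFin.
rewrite indicE; case: (boolP (x \in _)) => [/set_mem|_]; last by rewrite !mul0r mulr0.
rewrite -ball_normE/= distrC => xr.
rewrite !mul1r /w (max_idPl (psi_ge _ xr)) mulfK//.
by rewrite gt_eqF// (lt_le_trans _ (psi_ge _ xr))// divr_gt0.
Qed.

Lemma damping_cvg (q : R) : 0 <= q ->
  (1 + i%:R * q)^-1 @[i --> \oo] --> ((q == 0)%:R : R).
Proof.
move=> q0; have [->|qN0] := eqVneq q 0.
  rewrite (_ : (fun i : nat => _) = cst (1 : R)); first exact: cvg_cst.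
  by apply/funext => i; rewrite mulr0 addr0 invr1.
have qgt0 : 0 < q by rewrite lt_neqAle eq_sym qN0.
apply/cvgr0Pnorm_le => e e0; near=> i.
have i0 : (0 : R) <= i%:R by [].
have d0 : 0 < 1 + i%:R * q by rewrite ltr_pwDl// mulr_ge0.
rewrite normfV gtr0_norm// -[leRHS]invrK lef_pV2 ?posrE ?invr_gt0//.
apply: (@le_trans _ _ (i%:R * q)); last by rewrite lerDr.
by rewrite -ler_pdivrMr//; near: i; exact: nbhs_infty_ger.
Unshelve. all: by end_near. Qed.

Variables (p : R) (Omega : set 'rV[R]_n) (f : 'rV[R]_n -> 'rV[R]_N -> 'rV[R]_N)
  (u : 'rV[R]_n -> 'rV[R]_N).

Lemma critical_set_locally_null (l0 : 'I_N) x0 :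
  1 < p -> open Omega -> (forall l : 'I_N, C1_closure Omega (fun x => u x ord0 l)) ->
  weak_solution Omega p f u ->
  (forall (l : 'I_N) x, Omega x -> 0 < u x ord0 l) ->
  (forall (l : 'I_N) (j : 'I_n), W1p_loc Omega 2 (fun x => p_flux p u x l j)) ->
  positive_in Omega f -> Omega x0 ->
  exists2 U, nbhs x0 U & mu (critical_set Omega u `&` U) = 0%E.
Proof.
move=> p1 oO uC1 usol u0 fluxW f0 Ox0.
have /nbhs_ballP[d /= d0 dO] := open_nbhs_nbhs (conj oO Ox0).
(* Half the radius, so that even the closed ball lies in Omega. *)
pose r := d / 2.
have r0 : 0 < r by rewrite divr_gt0.
have KO x : `|x - x0| <= r -> Omega x.
  move=> xr; apply: dO; rewrite -ball_normE/= distrC (le_lt_trans xr)// /r; lra.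
have BK : ball x0 r `<=` [set x | `|x - x0| <= r].
  by move=> x; rewrite -ball_normE/= distrC => /ltW.
have BO : ball x0 r `<=` Omega by move=> x /BK; exact: KO.
have clB : closure (ball x0 r) `<=` [set x | `|x - x0| <= r].
  rewrite [X in _ `<=` X]((closure_id _).1 (@closed_dist_le _ _ x0 r)).
  exact: closure_subset.
have mB := @measurable_ball_rV R n x0 r.
pose V j x := p_flux p u x l0 j.
pose Vb j x := \1_(ball x0 r) x * V j x.
have cV j x : `|x - x0| <= r -> {for x, continuous (V j)}.
  by move=> xr; exact: (continuous_p_flux oO p1 uC1 (KO _ xr)).
have cVb j x : `|x - x0| < r -> {for x, continuous (Vb j)}.
  by move=> xr; apply: continuous_at_mul_indic => //; exact/cV/ltW.
have VbM j : exists M, forall x, `|Vb j x| <= M.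
  by apply: bounded_on_ball => x; exact: cV.
have mVb j : meas (Vb j).
  apply: measurable_mul_indic => //.
  apply: measurable_continuous_rV; first exact: ball_open.
  by move=> x /set_mem /BK; exact: cV.
have iVb j : intg (Vb j).
  have [M MP] := VbM j; apply: (@bounded_support_integrable _ _ _ x0 r M) => //.
  move=> x; rewrite /Vb indicE; case: (boolP (x \in _)) => [/set_mem//|_].
  by rewrite mul0r eqxx.
have /choice[G GP] j : exists G, in_Lp (ball x0 r) 2 G /\ weak_partial (ball x0 r) j (V j) G.
  have [||G [_ GP]] := fluxW l0 j (ball x0 r) (ball_open _ _).
  - apply: (subclosed_compact _ (@compact_dist_le _ _ x0 r) clB).
    exact: closed_closure.
  - by apply: subset_trans clB _ => x; exact: KO.
  by exists (G j); exact: GP.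
pose gb j x := \1_(ball x0 r) x * G j x.
have igb j : intg (gb j) by apply: integrable_L2_ball; exact: (GP j).1.
have weak j phi r' : smooth phi -> supp_in x0 r' phi -> r' < r ->
    \int[mu]_x (Vb j x * partial j phi x) = - \int[mu]_x (gb j x * phi x).
  move=> sphi sup rr; have := (GP j).2 _ (test_function_supp sphi sup rr).
  have e1 := integral_mul_indic (ball x0 r) (V j) (partial j phi).
  have e2 := integral_mul_indic (ball x0 r) (G j) phi.
  by rewrite e1 e2 => E; rewrite /Rintegral E fineN.
pose F x := \1_Omega x * f x (u x) ord0 l0.
have iFphi phi r' : r' < r -> smooth phi -> supp_in x0 r' phi -> intg (fun x => F x * phi x).
  by move=> rr sphi sup; have [] := scalar_equation l0 p1 oO usol BO rr sphi sup.
(* F is minus the weak divergence of the flux. *)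
have FG phi r' : r' < r -> smooth phi -> supp_in x0 r' phi ->
    \int[mu]_x (F x * phi x) = - \sum_j \int[mu]_x (gb j x * phi x).
  move=> rr sphi sup; have [_ E] := scalar_equation l0 p1 oO usol BO rr sphi sup.
  rewrite /Rintegral E -/(Rintegral mu setT _).
  have iVp j : intg (fun x => Vb j x * partial j phi x).
    have cd := smooth_continuous (smooth_partial j sphi).
    have [C _ dC] := bounded_supp cd (partial_supp (j := j) sup).
    exact: (integrable_mul_bounded (iVb j) (measurable_continuous cd) dC).
  rewrite (Rintegral_sum (index_enum 'I_n) iVp).2 -sumrN; apply: eq_bigr => j _.
  exact: (weak j phi r').
pose rho := r / 4.
have rho0 : 0 < rho by rewrite divr_gt0.
pose Fb x := \1_(ball x0 rho) x * F x.
have iFb : intg Fb by apply: (@local_integrability F x0 r) => //; rewrite /rho; lra.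
have [isg _] := Rintegral_sum (index_enum 'I_n) igb.
(* H is 0 almost everywhere on the smaller ball; this is used by duality only. *)
pose H x := Fb x + \sum_j gb j x.
have iH : intg H by exact: (integrableD measurableT iFb isg).
have Hsplit (zeta : 'rV[R]_n -> R) C : meas zeta -> (forall x, `|zeta x| <= C) ->
    \int[mu]_x (H x * zeta x) =
    \int[mu]_x (Fb x * zeta x) + \sum_j \int[mu]_x (gb j x * zeta x).
  move=> mz zC.
  have iFz := integrable_mul_bounded iFb mz zC.
  have igz j := integrable_mul_bounded (igb j) mz zC.
  have [isz <-] := Rintegral_sum (index_enum 'I_n) igz.
  rewrite -RintegralD//; apply: eq_Rintegral => x _.
  by rewrite /H mulrDl mulr_suml.
have Hsmooth psi r' : 0 <= r' -> r' < rho -> smooth psi -> supp_in x0 r' psi ->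
    \int[mu]_x (H x * psi x) = 0.
  move=> r'0 rr spsi sup.
  have cpsi := smooth_continuous spsi; have [C _ psiC] := bounded_supp cpsi sup.
  rewrite (Hsplit _ _ (measurable_continuous cpsi) psiC).
  have -> : \int[mu]_x (Fb x * psi x) = \int[mu]_x (F x * psi x).
    apply: eq_Rintegral => x _; rewrite /Fb.
    have [->|/sup xr] := eqVneq (psi x) 0; first by rewrite !mulr0.
    by rewrite indicE mem_set ?mul1r// -ball_normE/= distrC (le_lt_trans xr).
  rewrite (FG psi r')// ?addNr//.
  by apply: lt_trans rr _; rewrite /rho; lra.
have Hcont := @orthogonal_continuous R n H x0 rho iH Hsmooth.
pose zeta := tent x0 (rho / 2).
have cz : continuous zeta by exact: continuous_tent.
have sz : supp_in x0 (rho / 2) zeta by exact: supp_tent.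
have [C C0 zC] := bounded_supp cz sz.
pose Q x := \sum_j Vb j x ^+ 2.
have Q0 x : 0 <= Q x by apply: sumr_ge0 => j _; exact: sqr_ge0.
(* A continuous approximation of the indicator of the zero set of the flux row. *)
pose k (i : nat) x : R := (1 + i%:R * Q x)^-1.
have kd (i : nat) x : 1 <= 1 + i%:R * Q x by rewrite lerDl mulr_ge0.
have k01 i x : 0 <= k i x <= 1.
  by rewrite invr_ge0 (le_trans _ (kd i x))//= invf_le1// (lt_le_trans _ (kd i x)).
have rho2 : rho / 2 < r by rewrite /rho; lra.
pose a i x := k i x * zeta x.
have ca i : continuous (a i).
  apply: (continuousM_supp rho2 _ cz sz) => x xr.
  have cQ : {for x, continuous Q}.
    by apply: continuous_sum_at => j; exact: (continuousM (cVb j x xr) (cVb j x xr)).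
  have ck : {for x, continuous (fun y => 1 + i%:R * Q y)}.
    apply: (continuousD (@cst_continuous _ _ (1 : R) x)).
    exact: (continuousM (@cst_continuous _ _ (i%:R : R) x) cQ).
  have d1 : 1 + i%:R * Q x != 0 by rewrite gt_eqF// (lt_le_trans _ (kd i x)).
  exact: (cvgV d1 ck).
have sa i : supp_in x0 (rho / 2) (a i) by exact: supp_inM.
have aC i x : `|a i x| <= C.
  rewrite normrM -[C]mul1r; have /andP[k0 k1] := k01 i x.
  by rewrite ler_pM// ger0_norm.
have ma i := measurable_continuous (ca i).
pose chi x : R := (Q x == 0)%:R * zeta x.
have acv x : a i x @[i --> \oo] --> chi x.
  have h : k i x @[i --> \oo] --> ((Q x == 0)%:R : R) by exact: damping_cvg.
  exact: (cvgM h (cvg_cst (zeta x))).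
have mchi : meas chi by exact: (measurable_fun_cvg ma (fun x _ => acv x)).
have chiC x : `|chi x| <= C.
  by rewrite /chi; case: eqP => _; rewrite ?mul1r// mul0r normr0.
have rho20 : 0 <= rho / 2 by rewrite divr_ge0// ltW.
have rho2rho : rho / 2 < rho by lra.
have E1 : \int[mu]_x (H x * chi x) = 0.
  have lim := Rintegral_dominated iH ma aC acv.
  have lim0 : \int[mu]_x (H x * a i x) @[i --> \oo] --> (0 : R).
    rewrite (_ : (fun i => _) = cst (0 : R)); first exact: cvg_cst.
    by apply/funext => i; exact: (Hcont _ _ rho20 rho2rho (ca i) (sa i)).
  exact: (cvg_unique _ lim lim0).
(* On the support of chi all V_j vanish, so that the factor (V_j == 0) may be
   inserted, and the key fact applies to each a i. *)
have E2 j : \int[mu]_x (gb j x * chi x) = 0.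
  pose b i x : R := (Vb j x == 0)%:R * a i x.
  have m1 := measurable_eq0 (mVb j).
  have mb i : meas (b i) by exact: measurable_funM.
  have bC i x : `|b i x| <= C.
    by rewrite /b; case: eqP => _; rewrite ?mul1r// mul0r normr0.
  have bcv x : b i x @[i --> \oo] --> chi x.
    have -> : chi x = (Vb j x == 0)%:R * chi x.
      rewrite /chi; have [Qx|] := eqVneq (Q x) 0; last by rewrite !mul0r mulr0.
      suff -> : Vb j x = 0 by rewrite eqxx !mul1r.
      apply/eqP; rewrite -sqrf_eq0; apply/eqP/le_anti; rewrite sqr_ge0 andbT -Qx.
      by rewrite /Q (bigD1 j)//= lerDl sumr_ge0// => ? _; exact: sqr_ge0.
    exact: (cvgM (cvg_cst ((Vb j x == 0)%:R : R)) (acv x)).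
  have lim := Rintegral_dominated (igb j) mb bC bcv.
  have lim0 : \int[mu]_x (gb j x * b i x) @[i --> \oo] --> (0 : R).
    rewrite (_ : (fun i => _) = cst (0 : R)); first exact: cvg_cst.
    apply/funext => i; have [M MP] := VbM j.
    exact: (zero_level_continuous (iVb j) (igb j) MP (cVb j) (weak j) rho20 rho2 (ca i) (sa i)).
  exact: (cvg_unique _ lim lim0).
have E3 : \int[mu]_x (Fb x * chi x) = 0.
  by have := Hsplit _ _ mchi chiC; rewrite E1 big1 ?addr0// => j _; exact: E2.
have Fb_ge0 x : 0 <= Fb x.
  rewrite /Fb /F !indicE; case: (_ \in _); last by rewrite mul0r.
  rewrite mul1r; case: (boolP (x \in _)) => [/set_mem Ox|]; last by rewrite mul0r.
  by rewrite mul1r ltW// f0// => l; exact: u0.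
(* F chi is positive on the part of the critical set in this ball, and its integral
   is 0. *)
exists (ball x0 (rho / 2)); first by apply: nbhsx_ballx; rewrite divr_gt0.
apply/eqP; rewrite eq_le measure_ge0 andbT.
have iFc := integrable_mul_bounded iFb mchi chiC.
rewrite -(null_of_integral0 iFc _ E3); last first.
  by move=> x; rewrite mulr_ge0// /chi mulr_ge0// tent_ge0.
apply: le_mu_ext => x [[Ox Dx0] xB] /=.
have xr : `|x - x0| < rho / 2 by move: xB; rewrite -ball_normE/= distrC.
rewrite gt_eqF// mulr_gt0//.
  rewrite /Fb /F !indicE !mem_set//; last by rewrite -ball_normE/= distrC (lt_trans xr).
  by rewrite !mul1r f0// => l; exact: u0.
have -> : chi x = zeta x.
  rewrite /chi (_ : Q x = 0) ?eqxx ?mul1r//.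
  by rewrite /Q big1// => j _; rewrite /Vb /V p_flux_eq0// mulr0 expr0n.
exact: tent_gt0.
Qed.

End critical.

Theorem proposition3p2 (R : realType) (n N : nat) (p : R)
    (Omega : set 'rV[R]_n) (f : 'rV[R]_n -> 'rV[R]_N -> 'rV[R]_N)
    (u : 'rV[R]_n -> 'rV[R]_N)
    (n_ge2 : (2 <= n)%N) (N_ge1 : (1 <= N)%N) (p_gt1 : 1 < p)
    (Omega_domain : bounded_smooth_domain Omega)
    (u_C1 : forall l : 'I_N, C1_closure Omega (fun x => u x ord0 l))
    (u_solution : weak_solution Omega p f u)
    (u_gt0 : forall (l : 'I_N) x, Omega x -> 0 < u x ord0 l)
    (flux_W12loc : forall (l : 'I_N) (j : 'I_n),
      W1p_loc Omega 2 (fun x => p_flux p u x l j))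
    (f_gt0 : positive_in Omega f) :
  lebesgue_n R n (critical_set Omega u) = 0%E.
Proof.
have [oO _ _ _ _] := Omega_domain.
apply: null_of_locally_null => x [Ox _].
exact: (critical_set_locally_null (Ordinal N_ge1) p_gt1 oO u_C1 u_solution
  u_gt0 flux_W12loc f_gt0 Ox).
Qed.
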